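(* Let $V(\mu)$ be an irreducible polynomial $\mathfrak{gl}(m|n)$-module, with highest weight $\lambda$. For any fixed pair of distinct complex numbers $(z_1,z_2)$, the set of vectors $w(z_1,z_2,\boldsymbol t)$, as $\boldsymbol t$ runs over the solutions of the Bethe equations (for all tuples $\boldsymbol l=(l_1,\dots,l_{m+n-1})$ of non-negative integers, with sum $l$) $$-\frac{(\alpha_{c(i)},\epsilon_1)}{t_i-z_1}-\frac{(\alpha_{c(i)},\lambda)}{t_i-z_2}+\sum_{\substack{j=1\\ j\ne i}}^l\frac{(\alpha_{c(i)},\alpha_{c(j)})}{t_i-t_j}=0,\qquad i=1,\dots,l,$$ forms a basis of the space of singular vectors $\left(\mathbb C^{m|n}\otimes V(\mu)\right)^{\mathrm{sing}}$.
   Context: Lie superalgebra. $\mathbb C^{m|n}$ is the complex superspace with homogeneous basis $e_1,\dots,e_{m+n}$, $m$ of which are even and $n$ odd, in any fixed order subject to $e_1$ being even; $|a|\in\{0,1\}$ is the parity of $e_a$. $\mathfrak{gl}(m|n)$ has basis $E_{ab}$ ($1\le a,b\le m+n$) of parity $|a|+|b|$, with $[E_{ab},E_{cd}]=\delta_{bc}E_{ad}-(-1)^{(|a|+|b|)(|c|+|d|)}\delta_{ad}E_{cb}$; it acts on its defining representation $\mathbb C^{m|n}$ by $E_{ab}e_c=\delta_{bc}e_a$. $\mathfrak h$ is spanned by the $E_{aa}$, $\mathfrak n^+$ by the $E_{ab}$ with $a<b$. Let $\epsilon_a\in\mathfrak h^*$ be the basis dual to $E_{aa}$, with bilinear form $(\epsilon_a,\epsilon_b)=(-1)^{|a|}\delta_{ab}$;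 the simple roots are $\alpha_a=\epsilon_a-\epsilon_{a+1}$, and $F_a=E_{a+1,a}$ has parity $|F_a|$ equal to $|a|+|a+1|$ mod 2, $1\le a\le m+n-1$. Tensor products follow the super sign rule $(a\otimes b)(v\otimes w)=(-1)^{|b||v|}av\otimes bw$, and $X\in\mathfrak{gl}(m|n)$ acts via $\Delta X=X\otimes 1+1\otimes X$. A vector is singular if it is annihilated by $\mathfrak n^+$. Polynomial modules. The irreducible polynomial modules are the irreducible modules occurring as submodules of tensor powers $(\mathbb C^{m|n})^{\otimes k}$, $k\ge0$. They are in one-to-one correspondence with hook partitions $\mu$ (partitions with $\mu_{m+1}\le n$). The module attached to $\mu$ is $V(\mu)\cong L(\lambda)$, the irreducible highest weight module (with respect to $\mathfrak h\oplus\mathfrak n^+$) of highest weight $\lambda=\sum_a\lambda_a\epsilon_a$ read off from the Young diagram of $\mu$: for $a=1,2,\dots,m+n$ in turn, remove the first remaining row if $|a|=0$, or the first remaining column if $|a|=1$; $\lambda_a$ is the number of boxes removed at step $a$. Its fixed highest weight vector $v_\lambda$ is homogeneous for the $\mathbb Z_2$-grading, with parity left unspecified. Weight function. For $\boldsymbol l=(l_1,\dots,l_{m+n-1})$ with sum $l$, fix any function $c:\{1,\dots,l\}\to\{1,\dots,m+n-1\}$ such that $c^{-1}(p)$ has $l_p$ elements for all $p$. Put $v_1=e_1$, $v_2=v_\lambda$. Let $P_{l,2}$ be the set of tuples $\boldsymbol n=(n^1_1,\dots,n^1_{p_1};n^2_1,\dots,n^2_{p_2})$ with $p_k\ge0$,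 $p_1+p_2=l$, whose concatenation is a permutation of $(1,\dots,l)$. Put $F_{\boldsymbol n}v=F_{c(n^1_1)}\cdots F_{c(n^1_{p_1})}v_1\otimes F_{c(n^2_1)}\cdots F_{c(n^2_{p_2})}v_2$, $$\omega_{\boldsymbol n}=\prod_{k=1}^2\frac1{(t_{n^k_1}-t_{n^k_2})\cdots(t_{n^k_{p_k-1}}-t_{n^k_{p_k}})(t_{n^k_{p_k}}-z_k)}$$ (the $k$-th factor is $1$ if $p_k=0$), and let $(-1)^{|\boldsymbol n|}$ be $-1$ to the power of the number of pairs $i<j$ with $|F_{c(i)}|=|F_{c(j)}|=1$ such that $j$ appears before $i$ in the concatenated list. Then $w(z_1,z_2,\boldsymbol t)=\sum_{\boldsymbol n\in P_{l,2}}(-1)^{|\boldsymbol n|}\omega_{\boldsymbol n}F_{\boldsymbol n}v\in\mathbb C^{m|n}\otimes V(\mu)$. For $l=0$ there is one (trivial) solution, with $w=v_1\otimes v_2$.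
   Formalization: The basis is the set of nonzero w(z1,z2,t), since some solutions (e.g. gl(2|0), trivial V, l=(2)) give w=0; it is also proved that w=0 only if no nonzero singular vector has its weight. Solutions have t_i distinct and different from z1, z2. *)

(* Defs.v *)
From HB Require Import structures.
From mathcomp Require Import all_boot all_order all_algebra.
From mathcomp Require Import reals complex ring.

Set Implicit Arguments.
Unset Strict Implicit.
Unset Printing Implicit Defensive.

Import Order.TTheory GRing.Theory Num.Theory.
Local Open Scope ring_scope.

(* gl(m|n) is described by the parity function par : 'I_r.+1 -> bool of the
   homogeneous basis e_0, ..., e_r of C^{m|n} (true = odd, indices from 0), with
   m = #|[pred a | ~~ par a]| and n = #|[pred a | par a]|, so r = m + n - 1. *)

Definition parE (r : nat) (par : 'I_r.+1 -> bool) (a b : 'I_r.+1) : bool :=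
  par a (+) par b.

Record gl_module (R : realType) (r : nat) (par : 'I_r.+1 -> bool) := GlModule {
  gl_space :> vectType R[i];
  gl_part : bool -> {vspace gl_space};
  gl_act : 'I_r.+1 -> 'I_r.+1 -> 'End(gl_space);
  gl_part_full : (gl_part false + gl_part true = fullv)%VS;
  gl_part_direct : (gl_part false :&: gl_part true = 0)%VS;
  gl_act_part : forall a b q, (gl_act a b @: gl_part q
                 <= gl_part (q (+) parE par a b))%VS;
  gl_bracket : forall a b c d (v : gl_space),
    gl_act a b (gl_act c d v)
      - (-1) ^+ (parE par a b && parE par c d) *: gl_act c d (gl_act a b v)
    = (b == c)%:R *: gl_act a d v
      - (-1) ^+ (parE par a b && parE par c d) *: ((a == d)%:R *: gl_act c b v)
}.

Arguments gl_space {R r par} g.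
Arguments gl_part {R r par} g q.
Arguments gl_act {R r par} g a b.

(* The trivial module C^{1|0}. *)
Section Trivial.
Context (R : realType) (r : nat) (par : 'I_r.+1 -> bool).

Definition trivial_part (q : bool) : {vspace R[i]^o} :=
  if q then 0%VS else fullv.

Fact trivial_part_full : (trivial_part false + trivial_part true = fullv)%VS.
Proof. by rewrite /= addv0. Qed.

Fact trivial_part_direct : (trivial_part false :&: trivial_part true = 0)%VS.
Proof. by rewrite /= capv0. Qed.

Fact trivial_E_part (a b : 'I_r.+1) q :
  ((0 : 'End(R[i]^o)) @: trivial_part q <= trivial_part (q (+) parE par a b))%VS.
Proof. by apply/subvP => _ /memv_imgP[u _ ->]; rewrite lfunE mem0v. Qed.

Fact trivial_bracket (a b c d : 'I_r.+1) (v : R[i]^o) :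
  (0 : 'End(R[i]^o)) ((0 : 'End(R[i]^o)) v)
      - (-1) ^+ (parE par a b && parE par c d)
        *: (0 : 'End(R[i]^o)) ((0 : 'End(R[i]^o)) v)
    = (b == c)%:R *: (0 : 'End(R[i]^o)) v
      - (-1) ^+ (parE par a b && parE par c d)
        *: ((a == d)%:R *: (0 : 'End(R[i]^o)) v).
Proof. by rewrite !lfunE /= !scaler0. Qed.

Definition trivial_module : gl_module R par :=
  GlModule trivial_part_full trivial_part_direct trivial_E_part trivial_bracket.
End Trivial.

Section SignIdentity.
Import VectorInternalTheory.

Fact sign_identity (K : fieldType) (V : vectType K)
    (p q u w s A B s1 s2 s5 s6 : K) (x1 x2 x3 x4 x5 x6 Y : V) :
  p * s1 = s * B * p -> A * q = s * q * s2 ->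
  A * B * u = u * s5 -> A * B * w = w * s6 ->
  p *: (u *: x1 + s1 *: x2)
    + A *: (q *: x3 + B *: (u *: x5 - s *: (w *: x6) + s *: Y))
    - s *: (q *: (w *: x4 + s2 *: x3) + B *: (p *: x2 + A *: Y))
  = u *: (p *: x1 + s5 *: x5) - s *: (w *: (q *: x4 + s6 *: x6)).
Proof.
move=> /eqP; rewrite -subr_eq0 => /eqP hp /eqP; rewrite -subr_eq0 => /eqP hq.
move=> /eqP; rewrite -subr_eq0 => /eqP hu /eqP; rewrite -subr_eq0 => /eqP hw.
apply: v2r_inj; apply/rowP=> i; rewrite !(linearD, linearN, linearZ) /= !mxE.
apply/eqP; rewrite -subr_eq0; apply/eqP.
transitivity ((p * s1 - s * B * p) * v2r x2 0 i + (A * q - s * q * s2) * v2r x3 0 i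
  + (A * B * u - u * s5) * v2r x5 0 i - s * (A * B * w - w * s6) * v2r x6 0 i).
  by ring.
by rewrite hp hq hu hw mulr0 !mul0r oppr0 !addr0.
Qed.
End SignIdentity.

(* The module C^{m|n} (x) M.  An element f : {ffun 'I_r.+1 -> M} stands for
   \sum_a e_a (x) f a, so that
     E_cd (e_a (x) v) = E_cd e_a (x) v + (-1)^(|E_cd||a|) e_a (x) E_cd v. *)
Section NaturalTensor.
Context (R : realType) (r : nat) (par : 'I_r.+1 -> bool).
Context (M : gl_module R par).
Local Notation T := {ffun 'I_r.+1 -> M}.

Definition tensor_E_fun (c d : 'I_r.+1) (f : T) : T :=
  [ffun a => (a == c)%:R *: f d
             + (-1) ^+ (parE par c d && par a) *: gl_act M c d (f a)].

Fact tensor_E_linear c d : linear (tensor_E_fun c d).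
Proof.
move=> k f g; apply/ffunP=> a; rewrite !ffunE (linearP (gl_act M c d)) /=.
rewrite !scalerDr !scalerA addrACA.
by rewrite [_%:R * k]mulrC [_ ^+ _ * k]mulrC.
Qed.

HB.instance Definition _ c d :=
  GRing.isLinear.Build R[i] T T _ (tensor_E_fun c d) (tensor_E_linear c d).

Definition tensor_E c d : 'End(T) := linfun (tensor_E_fun c d).

Definition coord_fun (a : 'I_r.+1) (f : T) : M := f a.

Fact coord_linear a : linear (coord_fun a).
Proof. by move=> k f g; rewrite /coord_fun !ffunE. Qed.

HB.instance Definition _ a :=
  GRing.isLinear.Build R[i] T M _ (coord_fun a) (coord_linear a).

Definition tensor_part (q : bool) : {vspace T} :=
  (\bigcap_a (linfun (coord_fun a) @^-1: gl_part M (q (+) par a)))%VS.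

Lemma tensor_EE c d f a : tensor_E c d f a =
  (a == c)%:R *: f d + (-1) ^+ (parE par c d && par a) *: gl_act M c d (f a).
Proof. by rewrite lfunE ffunE. Qed.

Lemma mem_tensor_part q (f : T) :
  reflect (forall a, f a \in gl_part M (q (+) par a)) (f \in tensor_part q).
Proof.
rewrite memvE; apply: (iffP subv_bigcapP) => [h a | h a _].
  by have := h a isT; rewrite -memvE -memv_preim lfunE.
by rewrite -memvE -memv_preim lfunE; exact: h.
Qed.

Fact tensor_part_full : (tensor_part false + tensor_part true = fullv)%VS.
Proof.
apply/eqP; rewrite eqEsubv subvf /=; apply/subvP=> f _.
have dec (v : M) q : exists x : M * M,
    [&& v == x.1 + x.2, x.1 \in gl_part M q & x.2 \in gl_part M (~~ q)].
  have : v \in (gl_part M q + gl_part M (~~ q))%VS.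
    by case: q; rewrite ?[(gl_part M true + _)%VS]addvC gl_part_full memvf.
  by case/memv_addP=> x xq [y yq ->]; exists (x, y); rewrite eqxx xq yq.
pose x a := xchoose (dec (f a) (par a)).
have xP a := xchooseP (dec (f a) (par a)).
apply/memv_addP; exists [ffun a => (x a).1].
  by apply/mem_tensor_part=> a; rewrite ffunE addFb; case/and3P: (xP a).
exists [ffun a => (x a).2].
  by apply/mem_tensor_part=> a; rewrite ffunE addTb; case/and3P: (xP a).
by apply/ffunP=> a; rewrite !ffunE; case/and3P: (xP a) => /eqP.
Qed.

Fact tensor_part_direct : (tensor_part false :&: tensor_part true = 0)%VS.
Proof.
apply/eqP; rewrite -subv0; apply/subvP=> f.
rewrite memv_cap => /andP[/mem_tensor_part f0 /mem_tensor_part f1].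
rewrite memv0; apply/eqP/ffunP=> a; rewrite ffunE; apply/eqP.
rewrite -memv0 -(gl_part_direct M) memv_cap.
by have := f0 a; have := f1 a; case: (par a) => /= -> ->.
Qed.

Fact tensor_E_part c d q :
  (tensor_E c d @: tensor_part q <= tensor_part (q (+) parE par c d))%VS.
Proof.
apply/subvP=> _ /memv_imgP[f /mem_tensor_part fq ->].
apply/mem_tensor_part=> a; rewrite tensor_EE; apply: memvD.
  case: eqP => [->|_]; last by rewrite scale0r mem0v.
  rewrite scale1r; have -> : q (+) parE par c d (+) par c = q (+) par d.
    by rewrite /parE; case: (q) (par c) (par d) => [] [] [].
  exact: fq.
apply: memvZ; rewrite addbAC.
exact: (subvP (gl_act_part M c d (q (+) par a))) (memv_img _ (fq a)).
Qed.

Fact tensor_bracket a b c d (v : T) :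
  tensor_E a b (tensor_E c d v)
      - (-1) ^+ (parE par a b && parE par c d) *: tensor_E c d (tensor_E a b v)
    = (b == c)%:R *: tensor_E a d v
      - (-1) ^+ (parE par a b && parE par c d) *: ((a == d)%:R *: tensor_E c b v).
Proof.
apply/ffunP=> e; rewrite !(tensor_EE, ffunE) [d == a]eq_sym.
rewrite !(linearD (gl_act M _ _)) !(linearZ_LR (gl_act M _ _)) /=.
have hp : (e == a)%:R * (-1) ^+ (parE par c d && par b)
  = (-1) ^+ (parE par a b && parE par c d)
    * (-1) ^+ (parE par c d && par e) * (e == a)%:R :> R[i].
  case: eqP => [->|_]; last by rewrite mul0r mulr0.
  by rewrite /parE mul1r mulr1 -signr_addb; case: (par a) (par b) (par c) (par d)
    => [] [] [] [].
have hq : (-1) ^+ (parE par a b && par e) * (e == c)%:R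
  = (-1) ^+ (parE par a b && parE par c d)
    * (e == c)%:R * (-1) ^+ (parE par a b && par d) :> R[i].
  case: eqP => [->|_]; last by rewrite !mulr0 mul0r.
  by rewrite /parE !mulr1 -signr_addb; case: (par a) (par b) (par c) (par d)
    => [] [] [] [].
have hu : (-1) ^+ (parE par a b && par e) * (-1) ^+ (parE par c d && par e)
    * (b == c)%:R = (b == c)%:R * (-1) ^+ (parE par a d && par e) :> R[i].
  case: eqP => [->|_]; last by rewrite mulr0 mul0r.
  by rewrite /parE mul1r mulr1 -signr_addb; case: (par a) (par c) (par d) (par e)
    => [] [] [] [].
have hw : (-1) ^+ (parE par a b && par e) * (-1) ^+ (parE par c d && par e)
    * (a == d)%:R = (a == d)%:R * (-1) ^+ (parE par c b && par e) :> R[i].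
  case: eqP => [->|_]; last by rewrite mulr0 mul0r.
  by rewrite /parE mul1r mulr1 -signr_addb; case: (par b) (par c) (par d) (par e)
    => [] [] [] [].
have /eqP := gl_bracket a b c d (v e).
rewrite subr_eq => /eqP ->.
move: hp hq hu hw.
exact: sign_identity.
Qed.

Definition natural_tensor : gl_module R par :=
  GlModule tensor_part_full tensor_part_direct tensor_E_part tensor_bracket.
End NaturalTensor.

(* (C^{m|n})^{(x) k} *)
Definition tensor_power (R : realType) (r : nat) (par : 'I_r.+1 -> bool)
    (k : nat) : gl_module R par :=
  iter k (@natural_tensor R r par) (trivial_module R par).

(* The defining representation, e_a being the column delta_mx a 0 and E_ab acting
   by the elementary matrix delta_mx a b. *)
Section Natural.
Context (R : realType) (r : nat) (par : 'I_r.+1 -> bool).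
Local Notation T := 'cV[R[i]]_r.+1.

Definition natural_E (a b : 'I_r.+1) : 'End(T) :=
  linfun (mulmx (delta_mx a b : 'M[R[i]]_r.+1)).

Definition natural_part (q : bool) : {vspace T} :=
  (\sum_(a | par a == q) <[(delta_mx a 0)%R]>)%VS.

Lemma mem_natural_part q (x : T) :
  reflect (forall a, par a != q -> x a 0 = 0) (x \in natural_part q).
Proof.
apply: (iffP idP) => [/memv_sumP[f fq ->] a nq | h].
  rewrite summxE big1 // => b bq; have /vlineP[k ->] := fq b bq.
  rewrite !mxE; case: (a =P b) => [ab|_]; last by rewrite mulr0.
  by rewrite ab bq in nq.
have -> : x = \sum_(a | par a == q) x a 0 *: delta_mx a 0.
  apply/matrixP=> a j; rewrite ord1 summxE.
  case: (boolP (par a == q)) => aq.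
    rewrite (bigD1 a) //= big1 => [|b /andP[_ nb]].
      by rewrite !mxE !eqxx mulr1 addr0.
    by rewrite !mxE eq_sym (negPf nb) mulr0.
  rewrite h // big1 // => b bq; rewrite !mxE; case: eqP => [ab|_].
    by rewrite ab bq in aq.
  by rewrite mulr0.
by apply: memv_sumr => a aq; apply: memvZ; exact: memv_line.
Qed.

Lemma natural_EE a b (x : T) i : natural_E a b x i 0 = (i == a)%:R * x b 0.
Proof.
rewrite lfunE /= mxE (bigD1 b) //= big1 => [|j nj].
  by rewrite !mxE eqxx andbT addr0.
by rewrite mxE (negPf nj) andbF mul0r.
Qed.

Fact natural_part_full : (natural_part false + natural_part true = fullv)%VS.
Proof.
apply/eqP; rewrite eqEsubv subvf /=; apply/subvP=> x _; apply/memv_addP.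
exists (\col_a ((~~ par a)%:R * x a 0)).
  by apply/mem_natural_part=> a; rewrite mxE; case: (par a); rewrite ?mul0r.
exists (\col_a ((par a)%:R * x a 0)).
  by apply/mem_natural_part=> a; rewrite mxE; case: (par a); rewrite ?mul0r.
apply/matrixP=> a j; rewrite ord1 !mxE.
by case: (par a); rewrite mul0r mul1r ?add0r ?addr0.
Qed.

Fact natural_part_direct : (natural_part false :&: natural_part true = 0)%VS.
Proof.
apply/eqP; rewrite -subv0; apply/subvP=> x; rewrite memv_cap memv0.
move=> /andP[/mem_natural_part x0 /mem_natural_part x1].
apply/eqP/matrixP=> a j; rewrite ord1 mxE.
by case pa: (par a); [apply: x0 | apply: x1]; rewrite pa.
Qed.

Fact natural_E_part a b q :
  (natural_E a b @: natural_part q <= natural_part (q (+) parE par a b))%VS.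
Proof.
apply/subvP=> _ /memv_imgP[x /mem_natural_part xq ->].
apply/mem_natural_part=> i; rewrite natural_EE.
case: (i =P a) => [->|_] h; last by rewrite mul0r.
rewrite mul1r; apply: xq; apply: contra h => /eqP <-.
by rewrite /parE; case: (par a) (par b) => [] [].
Qed.

Fact natural_bracket a b c d (x : T) :
  natural_E a b (natural_E c d x)
      - (-1) ^+ (parE par a b && parE par c d) *: natural_E c d (natural_E a b x)
    = (b == c)%:R *: natural_E a d x
      - (-1) ^+ (parE par a b && parE par c d)
        *: ((a == d)%:R *: natural_E c b x).
Proof.
apply/matrixP=> i j; rewrite ord1 !(natural_EE, mxE).
by rewrite [d == a]eq_sym; ring.
Qed.

Definition natural_module : gl_module R par :=
  GlModule natural_part_full natural_part_direct natural_E_part natural_bracket.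
End Natural.

Definition pure_tensor (R : realType) (r : nat) (par : 'I_r.+1 -> bool)
    (M : gl_module R par) (x : natural_module R par) (v : M) : natural_tensor M :=
  [ffun a => x a 0 *: v].

Lemma act_pure_tensor (R : realType) (r : nat) (par : 'I_r.+1 -> bool)
    (M : gl_module R par) c d q (x : natural_module R par) (v : M) :
  x \in gl_part (natural_module R par) q ->
  gl_act (natural_tensor M) c d (pure_tensor x v)
  = pure_tensor (gl_act (natural_module R par) c d x) v
    + (-1) ^+ (parE par c d && q) *: pure_tensor x (gl_act M c d v).
Proof.
move=> /mem_natural_part xq; apply/ffunP=> a.
rewrite [LHS]tensor_EE !ffunE natural_EE (linearZ_LR (gl_act M c d)) /=.
rewrite !scalerA mulrC; congr (_ + _ *: _).
by case: (par a =P q) => [->|/eqP nq] //; rewrite xq // !mulr0.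
Qed.

Section Modules.
Context (R : realType) (r : nat) (par : 'I_r.+1 -> bool).
Implicit Type M : gl_module R par.

Definition singular M : {vspace M} :=
  (\bigcap_(ab : 'I_r.+1 * 'I_r.+1 | (ab.1 < ab.2)%N) lker (gl_act M ab.1 ab.2))%VS.

(* A weight is the row of its coordinates in the basis (epsilon_a). *)
Definition weight_space M (nu : 'rV[R[i]]_r.+1) : {vspace M} :=
  (\bigcap_a passmx.leigenspace (gl_act M a a) (nu ord0 a))%VS.

Definition submodule M (U : {vspace M}) : Prop :=
  (U = U :&: gl_part M false + U :&: gl_part M true)%VS
  /\ forall a b, (gl_act M a b @: U <= U)%VS.

Definition irreducible M : Prop :=
  (fullv != 0 :> {vspace M})%VS
  /\ forall U : {vspace M}, submodule U -> U = 0%VS \/ U = fullv.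

(* f may shift the grading by s: the parity of a highest weight vector is left
   unspecified. *)
Definition embeds M1 M2 : Prop :=
  exists (f : 'Hom(M1, M2)) (s : bool),
    [/\ lker f = 0%VS,
        forall q, (f @: gl_part M1 q <= gl_part M2 (q (+) s))%VS &
        forall a b v, f (gl_act M1 a b v) = gl_act M2 a b (f v)].

Definition irreducible_polynomial M : Prop :=
  irreducible M /\ exists k, embeds M (tensor_power R par k).

Definition highest_weight_vector M (lam : 'rV[R[i]]_r.+1) (v : M) : Prop :=
  [/\ v != 0, exists q, v \in gl_part M q, v \in singular M
    & v \in weight_space M lam].

Definition eps (a : 'I_r.+1) : 'rV[R[i]]_r.+1 := delta_mx 0 a.

Definition wt_form (x y : 'rV[R[i]]_r.+1) : R[i] :=
  \sum_a (-1) ^+ par a * x 0 a * y 0 a.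

(* p : 'I_r indexes the simple root alpha_p = eps_p - eps_(p+1). *)
Definition pos0 (p : 'I_r) : 'I_r.+1 := lift ord_max p.
Definition pos1 (p : 'I_r) : 'I_r.+1 := lift ord0 p.

Lemma pos0E p : pos0 p = p :> nat. Proof. exact: lift_max. Qed.
Lemma pos1E p : pos1 p = p.+1 :> nat. Proof. exact: lift0. Qed.

Definition alpha (p : 'I_r) : 'rV[R[i]]_r.+1 := eps (pos0 p) - eps (pos1 p).

Definition parF (p : 'I_r) : bool := parE par (pos1 p) (pos0 p).

(* F_(p1) ... F_(pk) v for ps = [:: p1; ...; pk] *)
Definition applyF M (ps : seq 'I_r) (v : M) : M :=
  foldr (fun p => gl_act M (pos1 p) (pos0 p)) v ps.

End Modules.

Definition is_partition (mu : seq nat) : bool := sorted geq mu && (0%N \notin mu).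

Definition hook_partition (m n : nat) (mu : seq nat) : bool :=
  is_partition mu && (nth 0%N mu m <= n)%N.

(* Removes successively the first row (parity false) or the first column (parity
   true) of the diagram mu, listing the numbers of boxes removed. *)
Fixpoint peel (ps : seq bool) (mu : seq nat) : seq nat :=
  match ps with
  | [::] => [::]
  | false :: ps' => head 0%N mu :: peel ps' (behead mu)
  | true :: ps' => size mu :: peel ps' [seq k.-1 | k <- mu & (1 < k)%N]
  end.

Definition hook_weight (R : realType) (r : nat) (par : 'I_r.+1 -> bool)
    (mu : seq nat) : 'rV[R[i]]_r.+1 :=
  \row_a (nth 0%N (peel [seq par b | b <- enum 'I_r.+1] mu) a)%:R.

Section WeightFunction.
Context (R : realType) (r : nat) (par : 'I_r.+1 -> bool).
Context (M : gl_module R par) (v : M) (L : nat) (c : 'I_L -> 'I_r).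
Context (z1 z2 : R[i]) (t : {ffun 'I_L -> R[i]}).
Implicit Type s : seq 'I_L.

Definition inversions s : nat :=
  #|[set ij : 'I_L * 'I_L |
      [&& ij.1 < ij.2, parF par (c ij.1), parF par (c ij.2)
        & index ij.2 s < index ij.1 s]%N]|.

(* 1 / ((t_(i1) - t_(i2)) ... (t_(i(k-1)) - t_(ik)) (t_(ik) - z))
   for s = [:: i1; ...; ik] *)
Fixpoint omega (z : R[i]) s : R[i] :=
  match s with
  | [::] => 1
  | i :: s' => (t i - (if s' is j :: _ then t j else z))^-1 * omega z s'
  end.

(* The tuple n = (n^1; n^2) is encoded by its concatenation s, a permutation of
   the indices, and by the length k = p_1 of n^1. *)
Definition weight_function : natural_tensor M :=
  \sum_(s <- permutations (enum 'I_L)) \sum_(k < L.+1)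
    ((-1) ^+ inversions s * (omega z1 (take k s) * omega z2 (drop k s))) *:
      pure_tensor (applyF [seq c i | i <- take k s]
              (delta_mx ord0 0 : natural_module R par))
           (applyF [seq c i | i <- drop k s] v).

(* The first three conditions say that no denominator of the weight function
   vanishes. *)
Definition bethe_solution (lam : 'rV[R[i]]_r.+1) : Prop :=
  [/\ injective t,
      forall i, t i != z1,
      forall i, t i != z2 &
      forall i,
        - (wt_form par (alpha R (c i)) (eps R ord0) / (t i - z1))
        - wt_form par (alpha R (c i)) lam / (t i - z2)
        + \sum_(j | j != i)
            wt_form par (alpha R (c i)) (alpha R (c j)) / (t i - t j) = 0].

End WeightFunction.

(* Main.v *)
Require Import Defs.
From mathcomp Require Import all_boot all_order all_algebra.
From mathcomp Require Import reals complex boolp ring zify.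

Set Implicit Arguments.
Unset Strict Implicit.
Unset Printing Implicit Defensive.

Import Order.TTheory GRing.Theory Num.Theory.
Local Open Scope ring_scope.

(** A tensor power of C^{m|n} carries a positive definite hermitian form with
    E_ab adjoint to E_ba; hence so do V and C^{m|n} (x) V.  Therefore the
    singular vectors of V are the multiples of v, and a singular vector of the
    tensor product has the form u = e_a (x) k v + \sum_(i < a) e_i (x) u_i, so it
    has weight lambda + eps_a and is determined up to a scalar by a.  Pairing
    the eigenvalue equation of the Casimir operator at u with e_i (x) u_i gives
      D_i |u_i|^2 = (-1)^|i| \sum_(d > i) |u_d|^2,
      D_i = (lambda, eps_i - eps_a) + \sum_(i < d < a) (-1)^|d|,
    which forces x_i = (-1)^|i| D_i > 0 for all i < a.

    In weight lambda + eps_a the Bethe equations have one unknown for each simple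
    root alpha_i with i < a and form a chain; eliminating from its end shows
    that their only possible solution is t_i - z2 = (z1 - z2) \prod_(j <= i)
    x_j / (1 + x_j).  When all x_j are positive these points are distinct and
    do solve the equations.  Conversely every Bethe vector is singular, and the
    one attached to a solution of the chain has a nonzero component along
    e_a (x) v.  So the Bethe solution for a exists exactly when there is a
    singular vector of weight lambda + eps_a, and the Bethe vector spans them.
    Bethe solutions for other l give singular vectors of a weight not of the
    form lambda + eps_a, that is, zero. *)

(** * Hermitian forms on polynomial modules *)

Section GlModules.
Context (R : realType) (r : nat) (par : 'I_r.+1 -> bool).
Implicit Type M : gl_module R par.

Definition psign (a : 'I_r.+1) : R[i] := (-1) ^+ par a.

Lemma psign_sq a : psign a * psign a = 1.
Proof. by rewrite /psign -signr_addb addbb. Qed.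

Lemma mem_singular M (x : M) :
  reflect (forall a b : 'I_r.+1, (a < b)%N -> gl_act M a b x = 0)
          (x \in singular M).
Proof.
rewrite memvE; apply: (iffP subv_bigcapP) => [h a b ab | h [a b] /= ab].
  by have := h (a, b) ab; rewrite -memvE memv_ker => /eqP.
by rewrite -memvE memv_ker h.
Qed.

Lemma mem_weight_space M (nu : 'rV[R[i]]_r.+1) (x : M) :
  reflect (forall a, gl_act M a a x = nu 0 a *: x) (x \in weight_space M nu).
Proof.
have E a : (gl_act M a a - nu ord0 a *: \1)%VF x = gl_act M a a x - nu 0 a *: x.
  by rewrite add_lfunE opp_lfunE scale_lfunE id_lfunE.
rewrite memvE; apply: (iffP subv_bigcapP) => [h a | h a _].
  by have := h a isT; rewrite -memvE memv_ker E subr_eq0 => /eqP.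
by rewrite -memvE memv_ker E h subrr.
Qed.

Lemma gl_actC M a b c d (x : M) :
  gl_act M a b (gl_act M c d x) =
    (-1) ^+ (parE par a b && parE par c d) *: gl_act M c d (gl_act M a b x)
    + ((b == c)%:R *: gl_act M a d x
       - (-1) ^+ (parE par a b && parE par c d) *: ((a == d)%:R *: gl_act M c b x)).
Proof. by rewrite -gl_bracket addrC subrK. Qed.

(** The simple root vectors generate n^+: for a < k, [E_(a,k+1)] is the bracket of [E_(a,k)] with
    [E_(k,k+1)], so induction on the second index reaches every [E_ab] with a < b. *)
Lemma simple_singular M (x : M) :
  (forall p, gl_act M (pos0 p) (pos1 p) x = 0) -> x \in singular M.
Proof.
move=> h; apply/mem_singular=> a b.
have [k bk] : {k | b = k :> nat} by exists (b : nat).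
elim: k b bk => [|k IH] b bk ab; first by rewrite bk in ab.
have kr : (k < r)%N by have := ltn_ord b; rewrite bk.
pose p : 'I_r := Ordinal kr.
have pb : pos1 p = b by apply/ord_inj; rewrite pos1E bk.
have := h p; rewrite pb.
have [ak|ak] := eqVneq (a : nat) k.
  have -> : pos0 p = a by apply/ord_inj; rewrite pos0E ak.
  by [].
move=> hb; have ap : (a < pos0 p)%N.
  by rewrite pos0E /=; move: ab; rewrite bk ltnS leq_eqVlt (negPf ak).
have hap := IH (pos0 p) (pos0E _) ap.
have := gl_actC a (pos0 p) (pos0 p) b x.
rewrite hb hap !linear0 eqxx scale1r add0r.
case: eqP => [e|_]; first by rewrite e ltnn in ab.
by rewrite scale0r scaler0 subr0 => <-.
Qed.

(** A unitarity structure: linear in the second variable, and [E_ab] is adjoint to [E_ba] with no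
    sign even for odd elements. *)
Record hermitian_form M := HermitianForm {
  hform :> M -> M -> R[i];
  hform_linear : forall x, linear_for *%R (hform x);
  hformC : forall x y, hform y x = (hform x y)^*;
  hform_pos : forall x, x != 0 -> 0 < hform x x;
  hform_act : forall a b x y, hform (gl_act M a b x) y = hform x (gl_act M b a y)
}.

Section HermTheory.
Context (M : gl_module R par) (H : hermitian_form M).

Lemma hformDr x y z : H x (y + z) = H x y + H x z.
Proof. by have := hform_linear H x 1 y z; rewrite scale1r mul1r. Qed.
Lemma hform0r x : H x 0 = 0.
Proof. by apply: (addrI (H x 0)); rewrite -hformDr !addr0. Qed.
Lemma hformZr k x y : H x (k *: y) = k * H x y.
Proof. by have := hform_linear H x k y 0; rewrite addr0 hform0r addr0. Qed.
Lemma hformNr x y : H x (- y) = - H x y.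
Proof. by rewrite -scaleN1r hformZr mulN1r. Qed.
Lemma hformBr x y z : H x (y - z) = H x y - H x z.
Proof. by rewrite hformDr hformNr. Qed.
Lemma hform0l x : H 0 x = 0.
Proof. by rewrite hformC hform0r conjC0. Qed.
Lemma hformDl x y z : H (x + y) z = H x z + H y z.
Proof. by rewrite hformC hformDr rmorphD /= -!hformC. Qed.
Lemma hformZl k x y : H (k *: x) y = k^* * H x y.
Proof. by rewrite hformC hformZr rmorphM /= -hformC. Qed.
Lemma hform_sumr (I : finType) (P : pred I) x (F : I -> M) :
  H x (\sum_(i | P i) F i) = \sum_(i | P i) H x (F i).
Proof. exact: (big_morph (H x) (hformDr x) (hform0r x)). Qed.
Lemma hform_ge0 x : 0 <= H x x.
Proof. by have [->|/(hform_pos H)/ltW //] := eqVneq x 0; rewrite hform0l. Qed.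
Lemma hform_eq0 x : H x x = 0 -> x = 0.
Proof. by move=> h; have [//|/(hform_pos H)] := eqVneq x 0; rewrite h ltxx. Qed.

Lemma orthogonal_projection (U : {vspace M}) x :
  exists2 y, y \in U & forall u, u \in U -> H u (x - y) = 0.
Proof.
rewrite -(span_basis (vbasisP U)); elim: (tval (vbasis U)) x => [|z s IH] x.
  exists 0; first by rewrite mem0v.
  by move=> u; rewrite span_nil memv0 => /eqP ->; rewrite hform0l.
have [z1 z1s z1P] := IH z; have [x1 x1s x1P] := IH x.
have sub u : u \in <<s>>%VS -> u \in <<z :: s>>%VS.
  by move=> us; rewrite span_cons -[u]add0r memv_add ?mem0v.
have zin : z \in <<z :: s>>%VS by rewrite memv_span ?mem_head.
(* Gram-Schmidt: [d] is the part of [z] orthogonal to the span of [s]. If [d = 0], the quotient is 0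
   and the orthogonality to [d] is trivial. *)
pose d := z - z1; pose k := H d x / H d d.
have ds u : u \in <<s>>%VS -> H d u = 0.
  by move=> us; rewrite hformC z1P // conjC0.
exists (x1 + k *: d).
  by rewrite memvD ?memvZ // ?memvB // ?sub.
have hd : H d (x - (x1 + k *: d)) = 0.
  rewrite hformBr hformDr (ds x1) // add0r hformZr /k.
  have [d0|d0] := eqVneq d 0; first by rewrite d0 !hform0l mulr0 subrr.
  by rewrite divfK ?subrr // gt_eqF ?hform_pos.
have hs u : u \in <<s>>%VS -> H u (x - (x1 + k *: d)) = 0.
  by move=> us; rewrite opprD addrA hformBr x1P // hformZr z1P // mulr0 subrr.
move=> u; rewrite span_cons => /memv_addP[_ /vlineP[c ->] [u' u's ->]].
have -> : c *: z + u' = c *: d + (c *: z1 + u').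
  by rewrite addrA -scalerDr subrK.
by rewrite hformDl hformZl hd mulr0 add0r hs // memvD ?memvZ.
Qed.

End HermTheory.

Lemma hform_trivial : inhabited (hermitian_form (trivial_module R par)).
Proof.
constructor; refine (@HermitianForm (trivial_module R par)
  (fun x y : R[i]^o => (x : R[i])^* * y) _ _ _ _).
- by move=> x k y z /=; rewrite mulrDr mulrCA.
- by move=> x y; rewrite rmorphM /= conjCK mulrC.
- move=> x x0; rewrite mulrC -normCK exprn_gt0 // normr_gt0 //.
- by move=> a b x y /=; rewrite !lfunE /= conjC0 mul0r mulr0.
Qed.

(** The orthogonal sum of copies of [H] works because elementary matrices satisfy the same
    adjunction and the sign of the second summand of the action is symmetric in [c] and [d]. *)
Lemma hform_natural_tensor M (H : hermitian_form M) :
  exists HT : hermitian_form (natural_tensor M),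
    forall f g, HT f g = \sum_a H (f a) (g a).
Proof.
unshelve refine (ex_intro _ (@HermitianForm (natural_tensor M)
  (fun f g : {ffun _ -> M} => \sum_a H (f a) (g a)) _ _ _ _) _) => //.
- move=> f k g g'; rewrite mulr_sumr -big_split; apply: eq_bigr => a _ /=.
  by rewrite !ffunE hformDr hformZr.
- by move=> f g; rewrite rmorph_sum; apply: eq_bigr => a _; exact: hformC.
- move=> f f0; have [a fa|h] := pickP (fun a => f a != 0); last first.
    by case/eqP: f0; apply/ffunP=> a; rewrite ffunE; apply/eqP/negbFE/h.
  rewrite (bigD1 a) //= ltr_pwDl ?hform_pos //; apply: sumr_ge0 => b _; exact: hform_ge0.
- move=> c d f g; under eq_bigr => a _ do rewrite [gl_act _ _ _]/= tensor_EE hformDl !hformZl.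
  under [RHS]eq_bigr => a _ do rewrite tensor_EE hformDr !hformZr.
  rewrite !big_split /=; congr (_ + _).
    rewrite (bigD1 c) //= big1 => [|a /negPf ->]; last by rewrite conjC0 mul0r.
    rewrite (bigD1 d) //= big1 => [|a /negPf ->]; last by rewrite mul0r.
    by rewrite !eqxx conjC1.
  apply: eq_bigr => a _; rewrite rmorphXn /= rmorphN1 hform_act; congr (_ ^+ _ * _).
  by rewrite /parE [par c (+) _]addbC.
Qed.

Lemma hform_embeds M1 M2 :
  embeds M1 M2 -> inhabited (hermitian_form M2) -> inhabited (hermitian_form M1).
Proof.
case=> f [s [f0 _ fE]] [H]; constructor.
refine (@HermitianForm M1 (fun x y => H (f x) (f y)) _ _ _ _).
- by move=> x k y z /=; rewrite linearP hformDr hformZr.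
- by move=> x y; rewrite hformC.
- move=> x x0; apply: hform_pos; apply: contra x0.
  by rewrite -memv_ker f0 memv0.
- by move=> a b x y /=; rewrite !fE hform_act.
Qed.

Lemma hform_tensor_power k : inhabited (hermitian_form (tensor_power R par k)).
Proof.
elim: k => [|k [H]]; first exact: hform_trivial.
by have [HT _] := hform_natural_tensor H; constructor.
Qed.

End GlModules.

(** * Singular vectors of an irreducible module *)

Section HighestWeight.
Context (R : realType) (r : nat) (par : 'I_r.+1 -> bool).

(** Take a subspace of maximal dimension inside [P]; adjoining a further vector of [P] cannot
    enlarge it. This turns the inductive predicate below into subspaces. *)
Lemma max_subspace (K : fieldType) (W : vectType K) (P : W -> Prop) :
  P 0 -> (forall k x y, P x -> P y -> P (k *: x + y)) ->
  exists U : {vspace W}, forall x, P x <-> x \in U.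
Proof.
move=> P0 Plin; pose Q n := `[< exists U : {vspace W}, (\dim U = n) /\ forall x, x \in U -> P x >].
have Q0 : exists n, Q n.
  exists 0%N; apply/asboolP; exists 0%VS; rewrite dimv0; split=> // x.
  by rewrite memv0 => /eqP ->.
have Qb n : Q n -> (n <= \dim {:W})%N.
  by case/asboolP => U [<- _]; apply: dimvS; exact: subvf.
case: (ex_maxnP Q0 Qb) => n /asboolP[U [Un UP]] nmax.
exists U => x; split=> [Px|]; last exact: UP.
have : Q (\dim (U + <[x]>)%VS).
  apply/asboolP; exists (U + <[x]>)%VS; split=> // _ /memv_addP[y yU [_ /vlineP[k ->] ->]].
  by rewrite addrC; apply: Plin => //; exact: UP.
move/nmax; rewrite -Un => le.
have /eqP -> : U == (U + <[x]>)%VS by rewrite eqEdim addvSl.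
by rewrite memvE addvSr.
Qed.

Context (V : gl_module R par) (lam : 'rV[R[i]]_r.+1) (v : V).
Context (irrV : irreducible V)
  (hv : highest_weight_vector lam v).

Lemma act_parity (M : gl_module R par) a b q (x : M) :
  x \in gl_part M q -> gl_act M a b x \in gl_part M (q (+) parE par a b).
Proof. by move=> xq; apply: (subvP (gl_act_part M a b q)); apply: memv_img. Qed.

(* Indexed by the parity because a submodule has to be the sum of its homogeneous parts. *)
Inductive lowered : bool -> V -> Prop :=
| LoweredHw q : v \in gl_part V q -> lowered q v
| LoweredZero q : lowered q 0
| LoweredLin q k x y : lowered q x -> lowered q y -> lowered q (k *: x + y)
| LoweredAct q (a b : 'I_r.+1) x : (b < a)%N -> lowered q x ->
    lowered (q (+) parE par a b) (gl_act V a b x).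

Lemma lowered_part q x : lowered q x -> x \in gl_part V q.
Proof.
elim=> // [q'|q' k x' y' _ IHx _ IHy|q' a b y ab _ IH].
- exact: mem0v.
- by rewrite memvD ?memvZ.
- exact: act_parity.
Qed.

Lemma lowered_scale q k x : lowered q x -> lowered q (k *: x).
Proof. by move=> h; rewrite -[_ *: _]addr0; apply: LoweredLin => //; constructor. Qed.

Lemma lowered_add q x y : lowered q x -> lowered q y -> lowered q (x + y).
Proof. by rewrite -{2}[x]scale1r; apply: LoweredLin. Qed.

(** Lowering operators are covered by a constructor. A raising or diagonal one is moved to the right
    through the word until it meets [v]; each commutator is an [E_ef] acting on a shorter word. *)
Lemma lowered_act q x : lowered q x ->
  forall a b, lowered (q (+) parE par a b) (gl_act V a b x).
Proof.
have [_ _ /mem_singular vs /mem_weight_space vw] := hv.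
suff up : lowered q x -> forall a b : 'I_r.+1, (a <= b)%N ->
    lowered (q (+) parE par a b) (gl_act V a b x).
  move=> h a b; have [ba|ab] := ltnP b a; first exact: LoweredAct.
  exact: up.
elim=> {q x} [q vq|q|q k x y _ IHx _ IHy|q c d x cd low IH] a b ab.
- move: ab; rewrite leq_eqVlt => /predU1P[/ord_inj ->|ab].
    rewrite vw; apply: lowered_scale; rewrite /parE addbb addbF.
    exact: LoweredHw.
  by rewrite vs //; constructor.
- by rewrite linear0; constructor.
- by rewrite linearP; apply: LoweredLin; [apply: IHx|apply: IHy].
have lowE e f : lowered (q (+) parE par e f) (gl_act V e f x).
  by have [fe|ef] := ltnP f e; [apply: LoweredAct|apply: IH].
rewrite gl_actC; apply: LoweredLin.
  by rewrite addbAC; apply: LoweredAct => //; exact: IH.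
rewrite -scaleNr; apply: lowered_add.
  case: (b =P c) => [->|_]; last by rewrite scale0r; constructor.
  rewrite scale1r.
  have -> : q (+) parE par c d (+) parE par a c = q (+) parE par a d; last exact: lowE.
  by rewrite /parE; case: (q) (par a) (par c) (par d) => [] [] [] [].
apply: lowered_scale; case: (a =P d) => [->|_]; last by rewrite scale0r; constructor.
rewrite scale1r.
have -> : q (+) parE par c d (+) parE par d b = q (+) parE par c b; last exact: lowE.
by rewrite /parE; case: (q) (par b) (par c) (par d) => [] [] [] [].
Qed.

(** The lowered vectors of the two parities together form a submodule containing [v], hence all of
    [V] by irreducibility. *)
Lemma lowered_span x : exists y z, [/\ lowered false y, lowered true z & x = y + z].
Proof.
have v0 : v != 0 by case: hv.
have lowU q : exists U : {vspace V}, forall x, lowered q x <-> x \in U.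
  by apply: max_subspace; [constructor|move=> *; apply: LoweredLin].
have [U0 U0P] := lowU false; have [U1 U1P] := lowU true.
have UE q (U : {vspace V}) : (forall x, lowered q x <-> x \in U) -> (U <= gl_part V q)%VS.
  by move=> UP; apply/subvP=> y /UP /lowered_part.
have sub : submodule (U0 + U1)%VS.
  split.
    apply/eqP; rewrite eqEsubv; apply/andP; split.
      by apply: addvS; rewrite subv_cap ?addvSl ?addvSr UE.
    by rewrite -[X in (_ <= X)%VS]addvv; apply: addvS; exact: capvSl.
  move=> a b; apply/subvP=> _ /memv_imgP[_ /memv_addP[y yU [z zU ->]] ->].
  rewrite linearD /=; move/U0P/lowered_act: yU => /(_ a b); move/U1P/lowered_act: zU => /(_ a b).
  case: (parE par a b) => /=.
    by rewrite addrC => /U0P yU /U1P zU; apply: memv_add.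
  by move=> /U1P yU /U0P zU; apply: memv_add.
have vin : v \in (U0 + U1)%VS.
  case: hv => _ [[] vq] _ _.
    by apply: (subvP (addvSr _ _)); apply/U1P; constructor.
  by apply: (subvP (addvSl _ _)); apply/U0P; constructor.
case: irrV => _ /(_ _ sub)[U00|Uf].
  by case/eqP: v0; apply/eqP; rewrite -memv0 -U00.
have : x \in (U0 + U1)%VS by rewrite Uf memvf.
by case/memv_addP=> y /U0P yU [z /U1P zU ->]; exists y, z.
Qed.

(** The part of [x] orthogonal to [v] is again singular, so by adjunction it is orthogonal to the
    image of every lowering operator. It is then orthogonal to all of [V], hence zero. *)
Lemma singular_irreducible (H : hermitian_form V) x :
  x \in singular V -> exists k, x = k *: v.
Proof.
have [v0 _ vs _] := hv.
move=> xs; pose k := H v x / H v v; exists k; apply/eqP; rewrite -subr_eq0; apply/eqP.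
pose y := x - k *: v.
have ys : y \in singular V by rewrite memvB ?memvZ.
have vy : H v y = 0 by rewrite hformBr hformZr divfK ?subrr ?gt_eqF ?hform_pos.
have low q z : lowered q z -> H z y = 0.
  elim=> [q' _|q'|q' c z1 z2 _ h1 _ h2|q' a b z' ab _ _] //.
  - by rewrite hform0l.
  - by rewrite hformDl hformZl h1 h2 mulr0 addr0.
  - by rewrite hform_act; move/mem_singular: ys => ->; rewrite ?hform0r.
apply: (hform_eq0 (H:=H)); rewrite -/y.
have [z1 [z2 [h1 h2 e]]] := lowered_span y.
by rewrite {1}e hformDl (low _ _ h1) (low _ _ h2) addr0.
Qed.

End HighestWeight.

(** * Singular vectors of the tensor product *)

Section TensorSingular.
Context (R : realType) (r : nat) (par : 'I_r.+1 -> bool) (V : gl_module R par).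
Local Notation T := (natural_tensor V).
Local Notation psign := (psign R par).

Lemma tensor_actE c d (f : T) a : (gl_act T c d f : {ffun _ -> V}) a =
  (a == c)%:R *: f d + (-1) ^+ (parE par c d && par a) *: gl_act V c d (f a).
Proof. exact: tensor_EE. Qed.

Lemma tensorZE k (f : T) a : (k *: f) a = k *: f a.
Proof. exact: ffunE. Qed.

Lemma tensorDE (f g : T) a : (f + g) a = f a + g a.
Proof. exact: ffunE. Qed.

Lemma tensorNE (f : T) a : (- f) a = - f a.
Proof. exact: ffunE. Qed.

(** This and the next lemma read [E_bd u = 0] coordinate by coordinate; the action on the natural
    factor contributes to coordinate [b] alone. *)
Lemma singular_diag (u : T) (b d : 'I_r.+1) : u \in singular T -> (b < d)%N ->
  gl_act V b d (u b) = - (-1) ^+ (parE par b d && par b) *: u d.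
Proof.
move=> /mem_singular us bd; have /ffunP/(_ b) := us b d bd.
rewrite tensor_actE ffunE eqxx scale1r => /eqP; rewrite addrC addr_eq0 => /eqP h.
rewrite scaleNr -scalerN -h scalerA -signr_addb addbb scale1r //.
Qed.

Lemma singular_offdiag (u : T) (b c d : 'I_r.+1) : u \in singular T ->
  (b < d)%N -> c != b -> gl_act V b d (u c) = 0.
Proof.
move=> /mem_singular us bd cb; have /ffunP/(_ c) := us b d bd.
rewrite tensor_actE ffunE (negPf cb) scale0r add0r => /eqP.
by rewrite scaler_eq0 signr_eq0 => /eqP.
Qed.

(* \sum_(i, j) (-1)^|j| E_ij (x) E_ji *)
Definition casimir (f : T) : T :=
  [ffun b => \sum_d (-1) ^+ (par b && par d) *: gl_act V d b ((f : {ffun _ -> V}) d)].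

Lemma casimirE f b : casimir f b = \sum_d (-1) ^+ (par b && par d) *: gl_act V d b (f d).
Proof. by rewrite ffunE. Qed.

Lemma casimir_comm i j f : casimir (gl_act T i j f) = gl_act T i j (casimir f).
Proof.
apply/ffunP=> b; rewrite casimirE tensor_actE !casimirE.
rewrite [gl_act V i j (\sum_(_ | _) _)]linear_sum /=.
under eq_bigr => d _ do rewrite tensor_actE linearD scalerDr !linearZ /=.
rewrite big_split /= [X in X + _ = _](bigD1 i) //= [X in _ + X + _ = _]big1 ?addr0; last first.
  by move=> d /negPf ->; rewrite scale0r.
rewrite eqxx scale1r.
(* Moving [E_ij] past [E_db] leaves two commutators. Summed over [d], the first survives at d = j
   and matches the natural-factor term on the left; the second cancels the one on the right. *)
have E d : (-1) ^+ (parE par i j && par b) *: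
      gl_act V i j ((-1) ^+ (par b && par d) *: gl_act V d b (f d))
  = (-1) ^+ (parE par i j && par d) *:
      ((-1) ^+ (par b && par d) *: gl_act V d b (gl_act V i j (f d)))
  + ((j == d)%:R *: ((-1) ^+ (par b && par i) *: gl_act V i b (f j))
    - (b == i)%:R *: ((-1) ^+ (par j && par d) *: gl_act V d j (f d))).
  rewrite linearZ /= gl_actC !scalerDr !scalerN !scalerA -!signr_addb.
  congr (_ + (_ - _)).
  - congr (_ *: _); congr (_ ^+ _).
    by rewrite /parE; case: (par i) (par j) (par b) (par d) => [] [] [] [].
  - case: (j =P d) => [->|_]; last by rewrite !mulr0 mul0r !scale0r.
    rewrite ?mulrA mulr1 mul1r -?signr_addb; congr (_ ^+ _ *: _).
    by rewrite /parE; case: (par i) (par d) (par b) => [] [] [].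
  - rewrite [b == i]eq_sym; case: (i =P b) => [<-|_]; last by rewrite !mulr0 mul0r !scale0r.
    rewrite ?mulrA mulr1 mul1r -?signr_addb; congr (_ ^+ _ *: _).
    by rewrite /parE; case: (par i) (par j) (par d) => [] [] [].
rewrite [X in _ = _ + X]scaler_sumr; under [X in _ = _ + X]eq_bigr => d _ do rewrite E.
rewrite [X in _ = _ + X]big_split /= sumrB [X in _ = _ + (_ + (X - _))](bigD1 j) //=.
rewrite [X in _ = _ + (_ + (_ + X - _))]big1 ?addr0; last first.
  by move=> d; rewrite eq_sym => /negPf ->; rewrite scale0r.
rewrite eqxx scale1r -scaler_sumr addrCA addrC; congr (_ + _).
by rewrite addrCA subrr addr0.
Qed.

Context (H : hermitian_form V) (HT : hermitian_form T).
Context (HTE : forall f g : T, HT f g = \sum_a H (f a) (g a)).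

Lemma casimir_adj f g : HT (casimir f) g = HT f (casimir g).
Proof.
rewrite !HTE.
under eq_bigr => b _ do rewrite casimirE (hformC H) hform_sumr rmorph_sum /=.
under [RHS]eq_bigr => b _ do rewrite casimirE hform_sumr.
rewrite exchange_big /=; apply: eq_bigr => b _; apply: eq_bigr => d _.
by rewrite -(hformC H) hformZl hformZr rmorphXn /= rmorphN1 hform_act andbC.
Qed.

(** A filtration of the singular vectors by their highest nonzero coordinate; all triangularity
    arguments below run along it. *)
Definition lower_singular (n : nat) : {vspace T} :=
  (singular T :&: \bigcap_(a : 'I_r.+1 | (n <= a)%N) lker (linfun (@coord_fun R r par V a)))%VS.

Lemma mem_lower_singular n (u : T) :
  reflect (u \in singular T /\ forall a : 'I_r.+1, (n <= a)%N -> u a = 0)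
    (u \in lower_singular n).
Proof.
rewrite memv_cap; apply: (iffP andP) => [[us h]|[us h]]; split=> //.
  move=> a na; move: h; rewrite memvE => /subv_bigcapP/(_ a na).
  by rewrite -memvE memv_ker lfunE /= => /eqP.
rewrite memvE; apply/subv_bigcapP=> a na; rewrite -memvE memv_ker lfunE /=.
by rewrite /coord_fun h.
Qed.

(** For d < a, singularity turns [E_da (u d)] into a multiple of [u a], so coordinates that vanish
    from [n] on still vanish. *)
Lemma casimir_lower n u : u \in lower_singular n -> casimir u \in lower_singular n.
Proof.
move=> /mem_lower_singular[us u0]; apply/mem_lower_singular; split.
  apply/mem_singular=> a b ab; rewrite -casimir_comm.
  have -> : gl_act T a b u = 0 by move/mem_singular: us => ->.
  by apply/ffunP=> c; rewrite casimirE ffunE big1 // => d _; rewrite ffunE linear0 scaler0.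
move=> a na; rewrite casimirE big1 // => d _; have [da|ad] := ltnP d a.
  by rewrite (singular_diag us da) u0 // !scaler0.
by rewrite u0 ?linear0 ?scaler0 // (leq_trans na).
Qed.

Lemma cartan_lower b n u : u \in lower_singular n -> gl_act T b b u \in lower_singular n.
Proof.
move=> /mem_lower_singular[us u0]; apply/mem_lower_singular; split; last first.
  by move=> a na; rewrite tensor_actE; case: eqP => [<-|_];
    rewrite !(u0 a na) ?scale0r ?(linear0, scaler0, addr0).
move/mem_singular: us => us; apply/mem_singular=> c d cd.
rewrite gl_actC us // linear0 scaler0 add0r.
have -> : (d == b)%:R *: gl_act T c b u = 0.
  by case: (d =P b) => [<-|_]; rewrite ?scale0r // us // scaler0.
have -> : (c == b)%:R *: gl_act T b d u = 0.
  by case: (c =P b) => [<-|_]; rewrite ?scale0r // us // scaler0.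
by rewrite scaler0 subrr.
Qed.

(** The vector [A u - c *: u] loses its coordinate [a], so it lies in the smaller step of the
    filtration. As [A] is self-adjoint and preserves that step, the vector is also orthogonal to it,
    hence to itself. *)
Lemma top_eigenvector (A : T -> T) (c : R[i]) (a : 'I_r.+1) u :
  (forall f g, HT (A f) g = HT f (A g)) ->
  (forall n f, f \in lower_singular n -> A f \in lower_singular n) ->
  u \in lower_singular a.+1 ->
  (forall y, y \in lower_singular a -> HT y u = 0) ->
  A u a = c *: u a -> A u = c *: u.
Proof.
move=> Aadj Alow ul uo Aua; apply/eqP; rewrite -subr_eq0; apply/eqP.
have yl : A u - c *: u \in lower_singular a.
  have : A u - c *: u \in lower_singular a.+1 by rewrite memvB ?memvZ ?Alow.
  move=> /mem_lower_singular[ys y0]; apply/mem_lower_singular; split=> // b.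
  rewrite leq_eqVlt => /predU1P[/ord_inj <-|]; last exact: y0.
  by rewrite !ffunE Aua subrr.
apply: (hform_eq0 (H:=HT)); rewrite hformBr -Aadj hformZr !uo ?mulr0 ?subrr //.
exact: Alow.
Qed.

Context (lam : 'rV[R[i]]_r.+1) (v : V).
Context (hv : highest_weight_vector lam v).

(** The number [D_i] of the introduction, obtained by comparing coordinates [a] and [i] of the
    Casimir eigenvalue equation. *)
Definition content_gap (a i : 'I_r.+1) : R[i] :=
  psign i * lam 0 i - psign a * lam 0 a + \sum_(d : 'I_r.+1 | (i < d < a)%N) psign d.

(* Subtracting from u its projection to the singular vectors with vanishing
   component at a yields an eigenvector of the Cartan elements and of the
   Casimir operator, so no weight decomposition is needed. *)
Lemma content_gap_gt0 (a i : 'I_r.+1) (u : T) :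
  u \in lower_singular a.+1 -> u a = v -> (i < a)%N ->
  0 < psign i * content_gap a i.
Proof.
have [v0 _ vs /mem_weight_space vw] := hv.
move=> u0l u0a ia.
have [y yl yo] := orthogonal_projection HT (lower_singular a) u.
set w := u - y in yo.
have /mem_lower_singular[ys y0] := yl.
have wa : w a = v by rewrite !ffunE y0 // oppr0 addr0.
have wl : w \in lower_singular a.+1.
  rewrite memvB //; apply/mem_lower_singular; split=> // b ab; apply: y0; exact: ltnW.
have /mem_lower_singular[ws w0] := wl.
(* The Casimir eigenvalue of [w], read off at coordinate [a], where [w a = v]. *)
pose c := psign a * lam 0 a - \sum_(d : 'I_r.+1 | (d < a)%N) psign d.
have down (d b : 'I_r.+1) : (d < b)%N ->
    (-1) ^+ (par b && par d) *: gl_act V d b (w d) = - psign d *: w b.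
  move=> db; rewrite (singular_diag ws db) scalerA mulrN -signr_addb /psign.
  by congr (- _ ^+ _ *: _); rewrite /parE; case: (par b) (par d) => [] [].
have cw : casimir w = c *: w.
  apply: (top_eigenvector (a := a)) => //; [exact: casimir_adj|exact: casimir_lower|].
  rewrite casimirE (bigD1 a) //= andbb wa vw scalerA -/(psign a).
  rewrite (bigID (fun d : 'I_r.+1 => (d < a)%N)) /= [X in _ + (_ + X)]big1 ?addr0; last first.
    move=> d /andP[da]; rewrite -leqNgt leq_eqVlt eq_sym => /predU1P[/ord_inj e|ad].
      by rewrite e eqxx in da.
    by rewrite w0 // linear0 scaler0.
  rewrite (eq_bigl (fun d : 'I_r.+1 => (d < a)%N)); last first.
    by move=> d; case: eqP => [->|]; rewrite ?ltnn.
  rewrite (eq_bigr (fun d => - psign d *: v)); last by move=> d da; rewrite down // wa.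
  by rewrite -scaler_suml -scalerDl sumrN.
(* The vector [w] has [E_ii]-weight [lam 0 i], of which [e_i] itself carries 1. *)
have ew : gl_act V i i (w i) = (lam 0 i - 1) *: w i.
  have E : gl_act T i i w = lam 0 i *: w.
    apply: (top_eigenvector (a := a)) => //; [by move=> *; exact: hform_act|exact: cartan_lower|].
    rewrite tensor_actE /parE addbb expr0 scale1r wa vw.
    by case: (a =P i) ia => [->|]; rewrite ?ltnn // scale0r add0r.
  have /ffunP/(_ i) := E; rewrite tensor_actE tensorZE eqxx scale1r /parE addbb scale1r.
  by move=> e; rewrite scalerBl scale1r -e addrC addKr.
pose N := \sum_(d : 'I_r.+1 | (i < d)%N) H (w d) (w d).
(* Coordinate [i] of the eigenvalue equation is paired with [w i]. For d > i, adjunction and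
   singularity turn the pairing with [E_di (w d)] into a multiple of the squared norm of [w d]. *)
have key : content_gap a i * H (w i) (w i) = psign i * N.
  have := congr1 (fun f : T => H (w i) (f i)) cw.
  rewrite /= casimirE tensorZE hformZr hform_sumr (bigD1 i) //= andbb -/(psign i) ew.
  rewrite scalerA hformZr (bigID (fun d : 'I_r.+1 => (d < i)%N)) /=.
  rewrite [X in _ + (X + _)](eq_bigl (fun d : 'I_r.+1 => (d < i)%N)); last first.
    by move=> d; case: eqP => [->|]; rewrite ?ltnn.
  rewrite [X in _ + (_ + X)](eq_bigl (fun d : 'I_r.+1 => (i < d)%N)); last first.
    by move=> d; rewrite -leqNgt [RHS]ltn_neqAle [d == i]eq_sym.
  rewrite (eq_bigr (fun d => - psign d * H (w i) (w i))); last first.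
    by move=> d di; rewrite down // hformZr.
  rewrite [X in _ + (_ + X)](eq_bigr (fun d => - psign i * H (w d) (w d))); last first.
    move=> d di; rewrite hformZr -hform_act (singular_diag ws di) hformZl.
    rewrite rmorphN rmorphXn /= rmorphN1 mulrA mulrN -signr_addb /psign; congr (- _ ^+ _ * _).
    by rewrite /parE; case: (par i) (par d) => [] [].
  rewrite -mulr_suml -mulr_sumr -/N sumrN /c.
  have -> : \sum_(d : 'I_r.+1 | (d < a)%N) psign d =
     \sum_(d : 'I_r.+1 | (d < i)%N) psign d + psign i + \sum_(d : 'I_r.+1 | (i < d < a)%N) psign d.
    rewrite (bigID (fun d : 'I_r.+1 => (d < i)%N)) /= -addrA; congr (_ + _).
      by apply: eq_bigl => d; apply: andb_idl => /ltn_trans; exact.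
    rewrite (bigD1 i) /=; last by rewrite ia ltnn.
    congr (_ + _); apply: eq_bigl => d.
    rewrite -leqNgt [(i < d)%N]ltn_neqAle.
    have -> : (d != i) = (i != d :> nat) by rewrite eq_sym.
    by case: (d < a)%N; case: (i <= d)%N; case: (i != d :> nat).
  move=> e; rewrite /content_gap.
  move: e; set S1 := \sum_(_ | _) _; set S2 := \sum_(_ | _) _; set h := H _ _ => e.
  apply/eqP; rewrite -subr_eq0; apply/eqP; move/eqP: e; rewrite -subr_eq0 => /eqP <-.
  ring.
have Npos : 0 < N.
  (* The summand at [a] is the squared norm of [v], which is positive. *)
  rewrite /N (bigD1 a) //= ltr_pwDl ?wa ?hform_pos //; apply: sumr_ge0 => d _; exact: hform_ge0.
have : 0 < psign i * content_gap a i * H (w i) (w i).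
  by rewrite -mulrA key mulrA psign_sq mul1r.
have [->|wi0] := eqVneq (w i) 0; first by rewrite hform0l mulr0 ltxx.
by rewrite pmulr_lgt0 // hform_pos.
Qed.

End TensorSingular.

(** * Bethe equations of a chain *)

Section Chain.
Context (F : numFieldType) (s sl : nat -> F) (a : nat) (z1 z2 : F).
Context (s_sq : forall n, s n * s n = 1) (z12 : z1 != z2).
Implicit Type T : nat -> F.

Definition gap p : F := sl p - sl a + \sum_(p.+1 <= d < a) s d.

(* The Bethe equation of the unknown T p.+1, with T 0 = z1 and sl p = s p * lambda_p. *)
Definition chain_eq T p : Prop :=
  s p / (T p.+1 - T p)
  + (if (p.+1 < a)%N then s p.+1 / (T p.+1 - T p.+2) else 0)
  + (sl p - sl p.+1) / (T p.+1 - z2) = 0.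

Definition chain_point n : F :=
  z2 + (z1 - z2) * \prod_(0 <= p < n) (s p * gap p / (1 + s p * gap p)).

Lemma chain_point0 : chain_point 0 = z1.
Proof. by rewrite /chain_point big_nil mulr1 addrC subrK. Qed.

Lemma chain_pointS n : (chain_point n.+1 - z2) =
  (chain_point n - z2) * (s n * gap n / (1 + s n * gap n)).
Proof. by rewrite /chain_point big_nat_recr //= ![z2 + _]addrC !addrK mulrA. Qed.

Lemma gap_last p : p.+1 = a -> gap p = sl p - sl p.+1.
Proof. by move=> pa; rewrite /gap pa big_geq // addr0. Qed.

Lemma gapS p : (p.+1 < a)%N -> gap p = sl p - sl p.+1 + s p.+1 + gap p.+1.
Proof. by move=> pa; rewrite /gap big_ltn //; ring. Qed.

Section Solutions.
Context (T : nat -> F).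
Context (Tz : forall n, (n <= a)%N -> T n != z2).
Context (Tinj : forall m n, (m < n <= a)%N -> T m != T n).

(** Multiplied by [T p.+1 - z2], equation [p] becomes linear in [G p] and [G p.+1], since [s q * (T
    q - z2) / (T q - T q.+1) = s q - G q]. *)
Let G p := s p * (T p.+1 - z2) / (T p.+1 - T p).

Lemma chain_eqE p : (p < a)%N ->
  chain_eq T p <->
  G p + (if (p.+1 < a)%N then s p.+1 - G p.+1 else 0) + (sl p - sl p.+1) = 0.
Proof.
move=> pa.
have n0 : T p.+1 - z2 != 0 by rewrite subr_eq0 Tz.
have n1 : T p.+1 - T p != 0 by rewrite subr_eq0 eq_sym Tinj // ltnSn.
have -> : G p + (if (p.+1 < a)%N then s p.+1 - G p.+1 else 0) + (sl p - sl p.+1)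
  = (T p.+1 - z2) * (s p / (T p.+1 - T p)
  + (if (p.+1 < a)%N then s p.+1 / (T p.+1 - T p.+2) else 0)
  + (sl p - sl p.+1) / (T p.+1 - z2)).
  rewrite /G; case: ifP => [pa1|_]; last by field; rewrite n0 n1.
  have n2 : T p.+2 - T p.+1 != 0 by rewrite subr_eq0 eq_sym Tinj // ltnSn.
  have n3 : T p.+1 - T p.+2 != 0 by rewrite subr_eq0 Tinj // ltnSn.
  by field; rewrite n0 n1 n2 n3.
by rewrite /chain_eq; split=> [->|/eqP]; rewrite ?mulr0 // mulf_eq0 (negPf n0) => /eqP.
Qed.

Lemma chain_gap : (forall p, (p < a)%N -> chain_eq T p) <->
  (forall p, (p < a)%N -> G p = - gap p).
Proof.
split=> h p pa; last first.
  apply/(chain_eqE pa); rewrite h //; case: ifP => pa1.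
    by rewrite h // (gapS pa1); ring.
  rewrite gap_last; first by ring.
  by apply/eqP; rewrite eqn_leq pa /= leqNgt pa1.
(* Induction on the distance to the end of the chain, where the last equation determines [G]
   outright. *)
have [m e] : {m | (a = p + m.+1)%N} by exists (a - p.+1)%N; rewrite subnSK // subnKC // ltnW.
elim: m p e pa => [|m IH] p e pa.
  have /(chain_eqE pa) := h p pa.
  have pa1 : p.+1 = a by rewrite e addn1.
  rewrite pa1 ltnn addr0 => /eqP; rewrite addr_eq0 => /eqP ->.
  by rewrite gap_last // pa1.
have pa1 : (p.+1 < a)%N by rewrite e -addSnnS -[X in (X < _)%N]addn0 ltn_add2l.
have /(chain_eqE pa) := h p pa; rewrite pa1 (IH p.+1) //; last by rewrite e addSnnS.
rewrite (gapS pa1) => e0.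
by apply/eqP; rewrite -subr_eq0; apply/eqP; rewrite -[RHS]e0; ring.
Qed.

(** The recursion for consecutive points, with denominators cleared because [1 + s p * gap p] is not
    yet known to be nonzero. *)
Lemma chain_step p : (p < a)%N ->
  G p = - gap p <-> (T p.+1 - z2) * (1 + s p * gap p) = (T p - z2) * (s p * gap p).
Proof.
move=> pa.
have n1 : T p.+1 - T p != 0 by rewrite subr_eq0 eq_sym Tinj // ltnSn.
have s0 : s p != 0.
  by apply/eqP => h; have := s_sq p; rewrite h mul0r => /esym/eqP; rewrite oner_eq0.
have E : (T p.+1 - z2) * (1 + s p * gap p) - (T p - z2) * (s p * gap p)
  = s p * (T p.+1 - T p) * (G p + gap p).
  rewrite /G -{1}[1](s_sq p); field; exact: n1.
split=> [h|h].
  by apply/eqP; rewrite -subr_eq0 E h addNr mulr0.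
apply/eqP; rewrite -addr_eq0; move/eqP: h; rewrite -subr_eq0 E mulf_eq0.
by rewrite mulf_eq0 (negPf s0) (negPf n1).
Qed.

Lemma chain_unique : T 0%N = z1 -> (forall p, (p < a)%N -> chain_eq T p) ->
  forall n, (n <= a)%N -> T n = chain_point n.
Proof.
move=> T0 /chain_gap h; elim=> [_|n IH na]; first by rewrite chain_point0.
have /(chain_step na) e := h n na.
apply: (addIr (- z2)); rewrite chain_pointS -IH 1?ltnW //.
(* If this vanished, the recursion and [T n != z2] would force [s n * gap n = 0], whence 1 = 0. *)
have d0 : 1 + s n * gap n != 0.
  apply/eqP => e0; move: e; rewrite e0 mulr0 => /esym/eqP.
  rewrite mulf_eq0 subr_eq0 (negPf (Tz _)) 1?ltnW //= => /eqP e1.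
  by move/eqP: e0; rewrite e1 addr0 oner_eq0.
by apply: (mulIf d0); rewrite e -[RHS]mulrA divfK.
Qed.

End Solutions.

Context (gap_pos : forall p, (p < a)%N -> 0 < s p * gap p).

(** Consequently the points move along the segment from [z1] towards [z2], strictly closer at each
    step and never reaching it; this gives their distinctness. *)
Lemma chain_factor p : (p < a)%N -> 0 < s p * gap p / (1 + s p * gap p) < 1.
Proof.
move=> pa; have x0 := gap_pos pa.
have y0 : 0 < 1 + s p * gap p by rewrite addr_gt0.
by rewrite divr_gt0 //= ltr_pdivrMr // mul1r ltrDr.
Qed.

Lemma chain_prod_gt0 n : (n <= a)%N ->
  0 < \prod_(0 <= p < n) (s p * gap p / (1 + s p * gap p)).
Proof.
elim: n => [_|n IH na]; first by rewrite big_nil.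
rewrite big_nat_recr //= mulr_gt0 ?IH 1?ltnW //.
by case/andP: (chain_factor na).
Qed.

Lemma chain_point_neq n : (n <= a)%N -> chain_point n != z2.
Proof.
move=> na; rewrite -subr_eq0 /chain_point addrC addKr mulf_neq0 ?subr_eq0 //.
by rewrite gt_eqF // chain_prod_gt0.
Qed.

Lemma chain_point_inj m n : (m < n <= a)%N -> chain_point m != chain_point n.
Proof.
move=> /andP[mn na]; rewrite /chain_point (inj_eq (addrI _)).
rewrite (inj_eq (mulfI _)) ?subr_eq0 // gt_eqF //.
elim: n mn na => // n IH; rewrite ltnS => mn na.
rewrite big_nat_recr //=; have /andP[f0 f1] := chain_factor na.
have lt : forall x : F, 0 < x -> x * (s n * gap n / (1 + s n * gap n)) < x.
  by move=> x x0; rewrite gtr_pMr.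
have := lt _ (chain_prod_gt0 (ltnW na)).
move: mn; rewrite leq_eqVlt => /predU1P[->//|mn].
by move/lt_trans; apply; apply: IH => //; exact: ltnW.
Qed.

Lemma chain_solution p : (p < a)%N -> chain_eq chain_point p.
Proof.
move: p; apply/(chain_gap chain_point_neq chain_point_inj) => p pa.
apply/(chain_step chain_point_inj pa).
rewrite chain_pointS mulrA divfK // gt_eqF // addr_gt0 // gap_pos //.
Qed.

End Chain.

(** * The bilinear form on weights *)

Section WtForm.
Context (R : realType) (r : nat) (par : 'I_r.+1 -> bool).
Local Notation psign := (psign R par).
Local Notation wt_form := (wt_form par).

Lemma wt_form_eps a (y : 'rV[R[i]]_r.+1) : wt_form (eps R a) y = psign a * y 0 a.
Proof.
rewrite /wt_form (bigD1 a) //= big1 ?addr0 => [|b ba].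
  by rewrite !mxE !eqxx mulr1.
by rewrite !mxE (negPf ba) andbF mulr0 mul0r.
Qed.

Lemma wt_formBl (x x' y : 'rV[R[i]]_r.+1) :
  wt_form (x - x') y = wt_form x y - wt_form x' y.
Proof. by rewrite /wt_form -sumrB; apply: eq_bigr => a _; rewrite !mxE; ring. Qed.

Lemma wt_formBr (x y y' : 'rV[R[i]]_r.+1) :
  wt_form x (y - y') = wt_form x y - wt_form x y'.
Proof. by rewrite /wt_form -sumrB; apply: eq_bigr => a _; rewrite !mxE; ring. Qed.

Lemma wt_form_alpha p (y : 'rV[R[i]]_r.+1) :
  wt_form (alpha R p) y = psign (pos0 p) * y 0 (pos0 p) - psign (pos1 p) * y 0 (pos1 p).
Proof. by rewrite wt_formBl !wt_form_eps. Qed.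

Lemma alphaE (p : 'I_r) (a : 'I_r.+1) :
  alpha R p 0 a = (p == a :> nat)%:R - (p.+1 == a :> nat)%:R.
Proof.
rewrite /alpha /eps !mxE !eqxx /= -[a == pos0 p]val_eqE -[a == pos1 p]val_eqE.
by rewrite [val (pos0 p)]pos0E [val (pos1 p)]pos1E ![val a == _]eq_sym.
Qed.

End WtForm.

(** * Bethe equations with one unknown for each simple root below a *)

Section ChainBethe.
Context (R : realType) (r : nat) (par : 'I_r.+1 -> bool).
Context (lam : 'rV[R[i]]_r.+1) (z1 z2 : R[i]) (z12 : z1 != z2) (a : 'I_r.+1).
Context (L : nat) (c : 'I_L -> 'I_r) (c_inj : injective c)
  (c_lt : forall i, (c i < a)%N) (c_surj : forall p : 'I_r, (p < a)%N -> exists i, c i = p).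
Local Notation psign := (psign R par).
Local Notation wt_form := (wt_form par).

(** The chain is indexed by natural numbers; [inord] has a default value beyond [r], but only
    indices up to [a] matter. *)
Let s n := psign (inord n).
Let sl n := s n * lam 0 (inord n).

Lemma sign_seq_sq n : s n * s n = 1. Proof. exact: psign_sq. Qed.

Lemma pos0_inord (p : 'I_r) : pos0 p = inord p.
Proof. by apply: ord_inj; rewrite pos0E inordK // ltnS ltnW. Qed.

Lemma pos1_inord (p : 'I_r) : pos1 p = inord p.+1.
Proof. by apply: ord_inj; rewrite pos1E inordK // ltnS. Qed.

Lemma gap_content i : (i < a)%N -> gap s sl a i = content_gap par lam a (inord i).
Proof.
move=> ia; have ir : (i < r.+1)%N := ltn_trans ia (ltn_ord a).
rewrite /gap /content_gap /sl /s inord_val; congr (_ + _).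
rewrite (big_nat_widen _ _ r.+1) 1?ltnW // big_geq_mkord; apply: eq_big => d.
  by rewrite inordK // andbC.
by rewrite inord_val.
Qed.

Let eqn (t : 'I_L -> R[i]) i :=
        - (wt_form (alpha R (c i)) (eps R ord0) / (t i - z1))
        - wt_form (alpha R (c i)) lam / (t i - z2)
        + \sum_(j | j != i)
            wt_form (alpha R (c i)) (alpha R (c j)) / (t i - t j).

Lemma bethe_chain_eq (t : 'I_L -> R[i]) (T : nat -> R[i]) i :
  T 0%N = z1 -> (forall j, t j = T (c j).+1) ->
  eqn t i = 0 <-> chain_eq s sl a z2 T (c i).
Proof.
move=> T0 tT.
(* There is exactly one unknown of colour [n] if n < a, and none otherwise. *)
have pick_sum (n : nat) (x : R[i]) : n != c i :> nat ->
    \sum_(j | j != i) (c j == n :> nat)%:R * x / (t i - t j)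
    = if (n < a)%N then x / (t i - T n.+1) else 0.
  move=> nci; case: ifP => na; last first.
    rewrite big1 // => j _; case: eqP => [e|_]; last by rewrite !mul0r.
    by rewrite -e c_lt in na.
  have nr : (n < r)%N by apply: leq_trans na _; rewrite -ltnS.
  have [k ck] := c_surj (p := Ordinal nr) na.
  rewrite (bigD1 k) /=; last first.
    by apply: contra nci => /eqP <-; rewrite ck.
  rewrite big1 => [|j /andP[_ jk]].
    by rewrite ck eqxx mul1r addr0 (tT k) ck.
  case: eqP => [e|_]; last by rewrite !mul0r.
  by case/eqP: jk; apply: c_inj; apply: ord_inj; rewrite ck e.
have E : eqn t i = - (s (c i) / (T (c i).+1 - T (c i))
  + (if ((c i).+1 < a)%N then s (c i).+1 / (T (c i).+1 - T (c i).+2) else 0)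
  + (sl (c i) - sl (c i).+1) / (T (c i).+1 - z2)).
  rewrite /eqn; set p := c i.
  have -> : wt_form (alpha R p) lam = sl p - sl p.+1.
    by rewrite wt_form_alpha /sl /s -pos0_inord -pos1_inord.
  (* Only the neighbouring colours p - 1 and p + 1 contribute. For p = 0 the missing left neighbour
     is supplied by the [eps R ord0] term, as [T 0 = z1]. *)
  have -> : \sum_(j | j != i) wt_form (alpha R p) (alpha R (c j)) / (t i - t j)
    = (if nat_of_ord p is p'.+1 then - s p / (t i - T p) else 0)
      + (if (p.+1 < a)%N then - s p.+1 / (t i - T p.+2) else 0).
    rewrite -pick_sum; last by rewrite neq_ltn ltnSn orbT.
    have -> : (if nat_of_ord p is p'.+1 then - s p / (t i - T p) else 0)
      = \sum_(j | j != i) ((c j).+1 == p :> nat)%:R * (- s p) / (t i - t j).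
      case ep: (nat_of_ord p) => [|p'].
        by rewrite big1 // => j _; rewrite !mul0r.
      rewrite [RHS](eq_bigr (fun j => (c j == p' :> nat)%:R * (- s p'.+1) / (t i - t j))) //.
      rewrite pick_sum.
        by rewrite (leq_trans _ (c_lt i)) // -/p ep.
      by rewrite -/p ep neq_ltn ltnSn.
    rewrite -big_split /=; apply: eq_bigr => j ji.
    rewrite -mulrDl; congr (_ / _).
    rewrite wt_form_alpha !alphaE pos0E pos1E /s -pos0_inord -pos1_inord.
    have cjp : (c j == p :> nat) = false by apply/negbTE; apply: contra ji => /eqP/ord_inj/c_inj ->.
    rewrite eqSS cjp mulr0n; ring.
  rewrite tT -/p wt_form_alpha !mxE.
  have -> : (pos1 p == ord0) = false by rewrite -val_eqE [val (pos1 p)]pos1E.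
  have -> : (pos0 p == ord0) = (nat_of_ord p == 0%N) by rewrite -val_eqE [val (pos0 p)]pos0E.
  rewrite pos0_inord eqxx /= mulr0 subr0 -/(s p).
  case ep: (nat_of_ord p) => [|p'] /=; rewrite ?T0 ?mulr1 ?mulr0 -ep; case: ifP => _;
    rewrite ?mulNr; ring.
by rewrite E /chain_eq; split=> [/eqP|->]; rewrite ?oppr0 // oppr_eq0 => /eqP.
Qed.

Definition chain_solution_fun : {ffun 'I_L -> R[i]} :=
  [ffun i => chain_point s sl a z1 z2 (c i).+1].

Lemma bethe_chain_unique (t : {ffun 'I_L -> R[i]}) :
  bethe_solution par c z1 z2 t lam -> t = chain_solution_fun.
Proof.
case=> tinj tz1 tz2 teq.
(* The unknowns sorted by colour and preceded by [z1]; the default 0 occurs only past the end of the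
   chain. *)
pose T n := if n is m.+1 then (if [pick i | c i == m :> nat] is Some i then t i else 0) else z1.
have tT i : t i = T (c i).+1.
  by rewrite /T; case: pickP => [j /eqP/ord_inj/c_inj -> //|/(_ i)]; rewrite eqxx.
have ex m : (m < a)%N -> exists2 i, c i = m :> nat & T m.+1 = t i.
  move=> ma; have mr : (m < r)%N by apply: leq_trans ma _; rewrite -ltnS.
  by have [i ci] := c_surj (p := Ordinal mr) ma; exists i; rewrite ?tT ci.
apply/ffunP=> i; rewrite ffunE tT; apply: (chain_unique sign_seq_sq (T := T)) => //.
- by case=> [_|m /ex[j _ ->]] //; exact: tz2.
- move=> m [|n] // /andP[mn na]; have [j cj ->] := ex n na.
  case: m mn => [_|m mn]; first by rewrite eq_sym tz1.
  have [k ck ->] := ex m (@ltn_trans n m a mn na).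
  by apply: contraTneq mn => /tinj kj; rewrite -ck kj cj ltnn.
- move=> p /ex[j cj _]; rewrite -cj; apply/(bethe_chain_eq (t := t)) => //; exact: teq.
Qed.

Lemma bethe_chain_solution :
  (forall i : 'I_r.+1, (i < a)%N -> 0 < psign i * content_gap par lam a i) ->
  bethe_solution par c z1 z2 chain_solution_fun lam.
Proof.
move=> pos.
have gpos p : (p < a)%N -> 0 < s p * gap s sl a p.
  move=> pa; rewrite gap_content // /s; apply: pos.
  by rewrite inordK // (ltn_trans pa).
have Tinj := chain_point_inj z12 gpos.
have T0 := chain_point0 s sl a z1 z2.
split.
- move=> i j; rewrite !ffunE => e; apply: c_inj; apply: ord_inj; apply/eqP.
  apply/negPn/negP; rewrite neq_ltn => /orP[] h.
    by have := Tinj (c i).+1 (c j).+1; rewrite e eqxx ltnS h c_lt => /(_ isT).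
  by have := Tinj (c j).+1 (c i).+1; rewrite e eqxx ltnS h c_lt => /(_ isT).
- by move=> i; rewrite ffunE -[X in _ != X]T0 eq_sym Tinj //= c_lt.
- by move=> i; rewrite ffunE; apply: chain_point_neq => //; exact: c_lt.
- move=> i; apply/(bethe_chain_eq (T := chain_point s sl a z1 z2)) => //.
    by move=> j; rewrite ffunE.
  by apply: chain_solution => //; exact: sign_seq_sq.
Qed.

End ChainBethe.

(** * Bethe vectors are singular *)

Section Insertion.
Context (I : eqType).
Implicit Type s : seq I.

Definition insert_at j i s := take j s ++ i :: drop j s.

Lemma insert_atS j i y s : insert_at j.+1 i (y :: s) = y :: insert_at j i s.
Proof. by []. Qed.

Lemma insert_at0 i s : insert_at 0 i s = i :: s.
Proof. by rewrite /insert_at take0 drop0. Qed.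

Lemma index_insert_at j i s : i \notin s -> (j <= size s)%N -> index i (insert_at j i s) = j.
Proof.
move=> ims js; rewrite /insert_at index_cat.
rewrite (negPf (contra (@mem_take _ _ _ i) ims)) /= eqxx addn0 size_takel //.
Qed.

Lemma rem_insert_at j i s : i \notin s -> rem i (insert_at j i s) = s.
Proof.
by elim: s j => [|y s IH] [|j] //=; rewrite ?eqxx // inE negb_or eq_sym => /andP[/negPf -> /IH h];
  rewrite h.
Qed.

Lemma insert_at_index i s : i \in s -> insert_at (index i s) i (rem i s) = s.
Proof.
elim: s => //= y s IH; case: eqP => [<-|yi]; first by rewrite insert_at0.
rewrite inE => /predU1P[/esym//|ims]; by rewrite insert_atS IH.
Qed.

Lemma perm_insert_at j i s : perm_eq (insert_at j i s) (i :: s).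
Proof. by rewrite perm_catC /= perm_cons perm_catC cat_take_drop. Qed.

Lemma take_insert_at j i s : (j <= size s)%N -> take j (insert_at j i s) = take j s.
Proof. by move=> js; rewrite /insert_at take_size_cat // size_takel. Qed.

Lemma drop_insert_at j i s : (j <= size s)%N -> drop j.+1 (insert_at j i s) = drop j s.
Proof. by move=> js; rewrite /insert_at -cat_rcons drop_size_cat // size_rcons size_takel. Qed.

Lemma take_insert_lt j k i s : (j <= k)%N -> take k.+1 (insert_at j i s) = insert_at j i (take k s).
Proof.
by elim: s j k => [|y s IH] [|j] [|k] //=;
  rewrite ?insert_at0 ?insert_atS //= => jk; rewrite IH.
Qed.

Lemma drop_insert_lt j k i s : (j <= k)%N -> (j <= size s)%N ->
  drop k.+1 (insert_at j i s) = drop k s.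
Proof.
by elim: s j k => [|y s IH] [|j] [|k] //=;
  rewrite ?insert_at0 ?insert_atS //= => jk js;
  exact: IH.
Qed.

Lemma take_insert_ge j k i s : (k <= j)%N -> (j <= size s)%N -> take k (insert_at j i s) = take k s.
Proof.
by elim: s j k => [|y s IH] [|j] [|k] //=;
  rewrite ?insert_at0 ?insert_atS //= => jk js; rewrite ?take0 ?IH.
Qed.

Lemma drop_insert_ge j k i s : (k <= j)%N -> (j <= size s)%N ->
  drop k (insert_at j i s) = insert_at (j - k) i (drop k s).
Proof.
by elim: s j k => [|y s IH] [|j] [|k] //=;
  rewrite ?insert_at0 ?insert_atS ?drop0 ?subn0 ?subSS //= => jk js;
  exact: IH.
Qed.

(** Deleting [i] from a permutation of [i :: s] and recording its position is inverse to
    insertion. *)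
Lemma sum_permutations_insert (W : nmodType) i s (G : seq I -> W) : uniq (i :: s) ->
  \sum_(u <- permutations (i :: s)) G u =
  \sum_(u <- permutations s) \sum_(0 <= j < (size s).+1) G (insert_at j i u).
Proof.
move=> /[dup] us /andP[ims su].
have memP u : u \in permutations s -> [/\ i \notin u & size u = size s].
  by rewrite mem_permutations => us'; rewrite (perm_mem us') (perm_size us').
have iotaE j : (j \in iota 0 (size s).+1) = (0 <= j < (size s).+1)%N by rewrite mem_iota add0n.
rewrite (perm_big [seq insert_at j i u | u <- permutations s, j <- iota 0 (size s).+1]).
  by rewrite big_allpairs_dep /index_iota subn0.
apply: uniq_perm; first exact: permutations_uniq.
  apply: allpairs_uniq; [exact: permutations_uniq|exact: iota_uniq|].
  move=> x y /allpairsP H1 /allpairsP H2.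
  case: H1 H2 => [[x1 y1]]; rewrite iotaE => -[/memP[x1i x1s] y1i ->].
  case=> [[x2 y2]]; rewrite iotaE => -[/memP[x2i x2s] y2i ->] e.
  move: e x1i x1s x2i x2s y1i y2i => /= e x1i x1s x2i x2s y1i y2i.
  have := congr1 (rem i) e; rewrite !rem_insert_at // => ->.
  have := congr1 (index i) e; rewrite !index_insert_at //; first by move->.
    by rewrite x2s -ltnS.
  by rewrite x1s -ltnS.
move=> u; rewrite mem_permutations; apply/idP/allpairsP => [pu|[[u' j] /= [u's' _ ->]]].
  have iu : i \in u by rewrite (perm_mem pu) mem_head.
  exists (rem i u, index i u); rewrite iotaE; split; last by rewrite insert_at_index.
    rewrite mem_permutations -(perm_cons i) (perm_trans _ pu) // perm_sym perm_to_rem //.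
  by rewrite /= -[(size s).+1](perm_size pu) index_mem.
by rewrite (perm_trans (perm_insert_at _ _ _)) // perm_cons -mem_permutations.
Qed.

End Insertion.

(** * Sums over insertion positions and cuts *)

Section InsertionSums.
Context (W : nmodType).

(** A cut at [k] puts a letter inserted at [j] into the first part ([X]) when j < k and into the
    second ([Y]) when k <= j. The right side is indexed by the cut of the word without that
    letter. *)
Lemma sum_cuts (n j : nat) (X Y : nat -> W) : (j <= n)%N ->
  \sum_(k < n.+2) ((if (j < k)%N then X k else 0) + (if (k <= j)%N then Y k else 0))
  = \sum_(k < n.+1) ((if (j <= k)%N then X k.+1 else 0) + (if (k <= j)%N then Y k else 0)).
Proof.
move=> jn; rewrite !big_split; congr (_ + _); first by rewrite big_ord_recl /= add0r.
by rewrite big_ord_recr /= ltnNge jn addr0.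
Qed.

Lemma sum_le (n k : nat) (g : nat -> W) : (k <= n)%N ->
  \sum_(0 <= j < n.+1) (if (j <= k)%N then g j else 0) = \sum_(0 <= j < k.+1) g j.
Proof.
move=> kn; rewrite (@big_cat_nat _ _ _ k.+1) //= [X in _ + X]big1_seq ?addr0.
  by apply: eq_big_nat => j; rewrite ltnS => /andP[_ ->].
by move=> j; rewrite mem_index_iota => /andP[_ /andP[kj _]]; rewrite leqNgt kj.
Qed.

Lemma sum_ge (n k : nat) (g : nat -> W) : (k <= n)%N ->
  \sum_(0 <= j < n.+1) (if (k <= j)%N then g (j - k)%N else 0) = \sum_(0 <= j < (n - k).+1) g j.
Proof.
move=> kn; rewrite (@big_cat_nat _ _ _ k) //=; last exact: leqW.
rewrite big1_seq ?add0r; last first.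
  by move=> j; rewrite mem_index_iota => /andP[_ /andP[_ jk]]; rewrite leqNgt jk.
rewrite -{1}[k]add0n big_addn subSn //; apply: eq_big_nat => j _.
by rewrite leq_addl addnK.
Qed.

End InsertionSums.

(** * Signs, rational functions and raising operators on words *)

Section Words.
Context (R : realType) (r : nat) (par : 'I_r.+1 -> bool) (L : nat) (c : 'I_L -> 'I_r).
Local Notation psign := (psign R par).
Local Notation wt_form := (wt_form par).
Implicit Type s : seq 'I_L.

Definition word_parity s := odd (count (fun i => parF par (c i)) s).

Lemma word_parity_cons i s : word_parity (i :: s) = parF par (c i) (+) word_parity s.
Proof. by rewrite /word_parity /= oddD oddb. Qed.

Lemma word_parity_cat s s' : word_parity (s ++ s') = word_parity s (+) word_parity s'.
Proof. by rewrite /word_parity count_cat oddD. Qed.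

Lemma odd_inversions s : odd (inversions par c s) =
  \big[addb/false]_(ij : 'I_L * 'I_L)
    [&& ij.1 < ij.2, parF par (c ij.1), parF par (c ij.2) & index ij.2 s < index ij.1 s]%N.
Proof.
rewrite /inversions cardsE -sum1_card big_mkcond (big_morph odd oddD (erefl _)).
by apply: eq_bigr => ij _; rewrite unfold_in; case: ifP.
Qed.

(** Only the pair of [x] and [y] changes its relative order, and it counts precisely when both
    letters are odd. *)
Lemma inversions_swap s1 x y s2 : x != y -> x \notin s1 -> y \notin s1 ->
  odd (inversions par c (s1 ++ x :: y :: s2)) =
  odd (inversions par c (s1 ++ y :: x :: s2)) (+) (parF par (c x) && parF par (c y)).
Proof.
move=> xy xs ys.
wlog ltxy : x y xy xs ys / (x < y)%N.
  move=> h; have := xy; rewrite -val_eqE neq_ltn => /orP[|lt]; first exact: h.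
  by rewrite (h y x) // 1?eq_sym // andbC -addbA addbb addbF.
rewrite !odd_inversions (bigD1 (x, y)) //= [in RHS](bigD1 (x, y)) //= ltxy /=.
have idx z (u : seq 'I_L) : index z (s1 ++ u) =
    (if z \in s1 then index z s1 else size s1 + index z u)%N.
  exact: index_cat.
rewrite !idx (negPf xs) (negPf ys) /= !eqxx [y == x]eq_sym (negPf xy) /=.
rewrite !ltn_add2l /= !andbF andbT addFb [RHS]addbC addbA addbb addFb.
apply: eq_bigr => -[a b] /= ab; rewrite !idx /=.
have [ltab/=|//] := boolP (a < b)%N; congr (_ && (_ && _)).
have mem_lt z : (z \in s1) ==> (index z s1 < size s1)%N by rewrite index_mem implybb.
have := mem_lt a; have := mem_lt b.
move: (index a s1) (index b s1) (index a s2) (index b s2) (size s1) => ia ib ja jb n.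
move: ab; rewrite xpair_eqE; case: (a \in s1); case: (b \in s1) => //= ab hb ha.
- by case: (x == b); case: (y == b); lia.
- by case: (x == a); case: (y == a); lia.
move: ab ltab {ha hb}; case: (x =P a) => [<-|_]; case: (y =P a) => [ya|_];
  case: (x =P b) => [<-|_]; case: (y =P b) => [yb|_] //=;
  rewrite -?ya -?yb ?eqxx ?(negPf xy) //= => _ ltab;
  move: ltab ltxy; rewrite -?ya -?yb ?[y == x]eq_sym ?(negPf xy); lia.
Qed.

(** The letter [i] is carried from the front to position [j] by adjacent swaps. *)
Lemma inversions_insert i s j : uniq (i :: s) -> (j <= size s)%N ->
  odd (inversions par c (insert_at j i s)) =
  odd (inversions par c (i :: s)) (+) (parF par (c i) && word_parity (take j s)).
Proof.
rewrite cons_uniq => /andP[ims us]; elim: j => [_|j IH js].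
  by rewrite insert_at0 take0 /word_parity /= andbF addbF.
have [y [s1 [s2 [es sz]]]] : exists y s1 s2, s = s1 ++ y :: s2 /\ size s1 = j.
  exists (nth i s j), (take j s), (drop j.+1 s); rewrite -drop_nth // cat_take_drop size_takel //.
  exact: ltnW.
have e := IH (ltnW js).
rewrite /insert_at es -sz take_size_cat // drop_size_cat // in e.
have es' : s = rcons s1 y ++ s2 by rewrite cat_rcons.
have sz' : j.+1 = size (rcons s1 y) by rewrite size_rcons sz.
have -> : take j.+1 s = rcons s1 y by rewrite es' sz' take_size_cat.
have -> : insert_at j.+1 i s = rcons s1 y ++ i :: s2.
  by rewrite /insert_at es' sz' take_size_cat // drop_size_cat.
have := ims; rewrite es mem_cat inE !negb_or => /and3P[is1 iy _].
have := us; rewrite es cat_uniq /= => /and3P[_ /norP[ys1 _] _].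
rewrite cat_rcons (inversions_swap _ (x := y) (y := i)) 1?eq_sym // e -es.
rewrite -cats1 word_parity_cat word_parity_cons [word_parity [::]]/word_parity /=.
by case: (odd _); case: (parF par (c i)); case: (parF par (c y)); case: (word_parity s1).
Qed.

(* By partial fractions, inserting i between two neighbours of s multiplies omega
   by a difference of two simple fractions; Abel summation does the rest. *)
Lemma omega_insert (t : {ffun 'I_L -> R[i]}) (z : R[i]) (nu x : 'rV[R[i]]_r.+1) i s :
  injective t -> (forall j, t j != z) -> uniq (i :: s) ->
  \sum_(0 <= j < (size s).+1)
     wt_form x (nu - \sum_(y <- drop j s) alpha R (c y)) * omega t z (insert_at j i s)
  = omega t z s * (wt_form x nu / (t i - z)
      - \sum_(y <- s) wt_form x (alpha R (c y)) / (t i - t y)).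
Proof.
move=> tinj tz; elim: s => [|y s IH].
  by rewrite big_nat1 /= !big_nil !subr0 mulr1 mul1r.
move=> /= /andP[]; rewrite inE negb_or => /andP[iy ims] /andP[ys us].
(* The point subtracted from that of the letter preceding [s] in the denominators of [omega]. *)
pose X := if s is j :: _ then t j else z.
have ne (j k : 'I_L) : j != k -> t j - t k != 0.
  by move=> jk; rewrite subr_eq0; apply: contra jk => /eqP/tinj ->.
have hiX : t i - X != 0.
  rewrite /X; case: (s) ims => [|k s']; first by rewrite subr_eq0 tz.
  by rewrite inE negb_or => /andP[ik _]; exact: ne.
have hyX : t y - X != 0.
  rewrite /X; case: (s) ys => [|k s']; first by rewrite subr_eq0 tz.
  by rewrite inE negb_or => /andP[ik _]; exact: ne.
have hiy := ne _ _ iy; have hyi : t y - t i != 0 by rewrite ne // eq_sym.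
pose w u := wt_form x (nu - \sum_(y <- u) alpha R (c y)).
have IHs := IH; rewrite /= ims us in IHs; move: {IHs}(IHs isT).
rewrite big_nat_recl // drop0 insert_at0 [omega t z (i :: s)]/= -/X -/(w s) => IHs.
rewrite big_nat_recl // big_nat_recl //.
(* Positions 0 and 1 are split off. From position 2 on the factor of [y] does not change, so the
   rest is the sum of the induction hypothesis without its first term. *)
have -> : \sum_(0 <= j < size s) wt_form x (nu - \sum_(y0 <- drop j.+2 (y :: s)) alpha R (c y0))
      * omega t z (insert_at j.+2 i (y :: s))
   = (t y - X)^-1 * \sum_(0 <= j < size s) wt_form x (nu - \sum_(y0 <- drop j.+1 s) alpha R (c y0))
      * omega t z (insert_at j.+1 i s).
  rewrite mulr_sumr; apply: eq_big_nat => j /andP[_ js].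
  rewrite [drop _ _]/= insert_atS mulrCA; congr (_ * _).
  by rewrite /X; case: (s) js => // k s' _; rewrite insert_atS.
rewrite drop0 !insert_atS !insert_at0 [drop 1 _]/= drop0 /= -/X -/(w s).
have -> : wt_form x (nu - \sum_(y <- y :: s) alpha R (c y)) = w s - wt_form x (alpha R (c y)).
  by rewrite big_cons opprD addrCA addrC wt_formBr.
rewrite big_cons.
have {IHs} -> : \sum_(0 <= j < size s) wt_form x (nu - \sum_(y0 <- drop j.+1 s) alpha R (c y0))
      * omega t z (insert_at j.+1 i s) =
   omega t z s * (wt_form x nu / (t i - z) - \sum_(y <- s) wt_form x (alpha R (c y)) / (t i - t y))
    - w s * ((t i - X)^-1 * omega t z s).
  by rewrite -IHs addrC addKr.
set S := \sum_(_ <- _) _; set Z := wt_form x nu / _.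
by field; rewrite hiX hyX hiy hyi.
Qed.

Section Module.
Context (N : gl_module R par) (x : N) (nu : 'rV[R[i]]_r.+1).
Context (xs : x \in singular N) (xw : x \in weight_space N nu).

Lemma applyF_part q s : x \in gl_part N q ->
  applyF [seq c i | i <- s] x \in gl_part N (q (+) word_parity s).
Proof.
move=> xq; elim: s => [|i s IH] /=; first by rewrite addbF.
by rewrite word_parity_cons addbCA addbC; exact: act_parity.
Qed.

Lemma applyF_weight ps : applyF ps x \in weight_space N (nu - \sum_(p <- ps) alpha R p).
Proof.
elim: ps => [|p ps /mem_weight_space IH]; first by rewrite big_nil subr0.
apply/mem_weight_space => a; rewrite /= gl_actC IH /parE addbb /= expr0 !scale1r linearZ /=.
rewrite big_cons; set S := \sum_(_ <- _) _; set y := applyF ps x.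
have -> : (nu - (alpha R p + S)) 0 a = (nu - S) 0 a - alpha R p 0 a.
  by rewrite !mxE; ring.
rewrite [RHS]scalerBl; congr (_ + _).
have -> : (a == pos1 p)%:R *: gl_act N a (pos0 p) y
    = (a == pos1 p)%:R *: gl_act N (pos1 p) (pos0 p) y.
  by case: eqP => [->|] //; rewrite !scale0r.
have -> : (a == pos0 p)%:R *: gl_act N (pos1 p) a y
    = (a == pos0 p)%:R *: gl_act N (pos1 p) (pos0 p) y.
  by case: eqP => [->|] //; rewrite !scale0r.
have -> : alpha R p 0 a = (a == pos0 p)%:R - (a == pos1 p)%:R.
  by rewrite /alpha /eps !mxE !eqxx.
by rewrite -scalerBl -scaleNr opprB.
Qed.

(** The bracket of [E_p] and [F_q] vanishes unless p = q, when it is a Cartan element acting on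
    weight [eta] by [psign (pos0 p) * wt_form (alpha R p) eta]. *)
Lemma raise_lower p q (y : N) eta : y \in weight_space N eta ->
  gl_act N (pos0 p) (pos1 p) (gl_act N (pos1 q) (pos0 q) y) =
  (-1) ^+ (parF par p && parF par q) *: gl_act N (pos1 q) (pos0 q) (gl_act N (pos0 p) (pos1 p) y)
  + ((q == p)%:R * (psign (pos0 p) * wt_form (alpha R p) eta)) *: y.
Proof.
move=> /mem_weight_space yw; rewrite gl_actC.
have -> : parE par (pos0 p) (pos1 p) = parF par p by rewrite /parF /parE addbC.
have -> : parE par (pos1 q) (pos0 q) = parF par q by [].
congr (_ + _).
have -> : (pos1 p == pos1 q) = (q == p) by rewrite (inj_eq lift_inj) eq_sym.
have -> : (pos0 p == pos0 q) = (q == p) by rewrite (inj_eq lift_inj) eq_sym.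
case: (q =P p) => [->|_]; last by rewrite !scale0r mul0r scaler0 subrr scale0r.
rewrite !yw !scale1r mul1r scalerA -scalerBl andbb; congr (_ *: _).
rewrite wt_form_alpha mulrBr !mulrA psign_sq mul1r; congr (_ - _ * _).
by rewrite /psign -signr_addb /parF /parE addbC.
Qed.

(** The raising operator is moved to the right until it kills [x]. Each letter of colour [p] is
    deleted in turn, with a sign from the letters on its left and a scalar from the weight of the
    word on its right. *)
Lemma raise_word p s : uniq s ->
  gl_act N (pos0 p) (pos1 p) (applyF [seq c i | i <- s] x) =
  \sum_(i <- s | c i == p)
    ((-1) ^+ (parF par p && word_parity (take (index i s) s)) *
      (psign (pos0 p) *
        wt_form (alpha R p) (nu - \sum_(y <- drop (index i s).+1 s) alpha R (c y)))) *:
    applyF [seq c j | j <- rem i s] x.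
Proof.
elim: s => [_|y s IH] /=; first by rewrite big_nil;
  move/mem_singular: xs => -> //; rewrite pos0E pos1E.
move=> /andP[ys us].
rewrite (raise_lower _ _ (applyF_weight _)) IH // big_map big_cons eqxx /= linear_sum scaler_sumr.
rewrite [X in X + _ = _](_ : _ = \sum_(i <- s | c i == p)
    ((-1) ^+ (parF par p && word_parity (take (index i (y :: s)) (y :: s))) *
      (psign (pos0 p) *
        wt_form (alpha R p)
          (nu - \sum_(y0 <- drop (index i (y :: s)).+1 (y :: s)) alpha R (c y0)))) *:
    applyF [seq c j | j <- rem i (y :: s)] x).
  rewrite addrC [word_parity [::]]/word_parity /= andbF drop0 mul1r.
  by case: (c y == p); rewrite ?mul1r // mul0r scale0r add0r.
rewrite [LHS]big_seq_cond [RHS]big_seq_cond; apply: eq_bigr => i /andP[ims _] /=.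
have /negPf yi : y != i by apply: contraNneq ys => ->.
rewrite yi /= linearZ /= scalerA mulrA -signr_addb word_parity_cons andb_addr //.
Qed.

End Module.

End Words.

(** * Pure tensors and the highest weight vector of the natural module *)

Section PureTensor.
Context (R : realType) (r : nat) (par : 'I_r.+1 -> bool) (V : gl_module R par).
Local Notation N0 := (natural_module R par).

Lemma pure_tensorE (x : N0) (y : V) a : pure_tensor x y a = x a 0 *: y.
Proof. exact: ffunE. Qed.

Lemma pure_tensor_suml (I : Type) (s : seq I) (P : pred I) (k : I -> R[i]) (x : I -> N0) (y : V) :
  pure_tensor (\sum_(i <- s | P i) k i *: x i) y =
  \sum_(i <- s | P i) k i *: pure_tensor (x i) y :> natural_tensor V.
Proof.
apply/ffunP=> a; rewrite pure_tensorE summxE scaler_suml sum_ffunE.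
by apply: eq_bigr => i _; rewrite !mxE tensorZE pure_tensorE scalerA.
Qed.

Lemma pure_tensor_sumr (I : Type) (s : seq I) (P : pred I) (k : I -> R[i]) (x : N0) (y : I -> V) :
  pure_tensor x (\sum_(i <- s | P i) k i *: y i) =
  \sum_(i <- s | P i) k i *: pure_tensor x (y i) :> natural_tensor V.
Proof.
apply/ffunP=> a; rewrite pure_tensorE scaler_sumr sum_ffunE.
by apply: eq_bigr => i _; rewrite tensorZE pure_tensorE !scalerA mulrC.
Qed.

Definition natural_hw : N0 := delta_mx ord0 0.

Lemma natural_hw_singular : natural_hw \in singular N0.
Proof.
apply/mem_singular=> a b ab; apply/matrixP=> i j; rewrite ord1 [LHS]natural_EE !mxE.
by case: (b =P ord0) ab => [->|_] //; rewrite mulr0.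
Qed.

Lemma natural_hw_weight : natural_hw \in weight_space N0 (eps R ord0).
Proof.
apply/mem_weight_space=> a; apply/matrixP=> i j; rewrite ord1 [LHS]natural_EE !mxE !eqxx !andbT.
rewrite /=; case: (i =P a) => [->|ia]; first by case: (a == ord0); rewrite ?mul1r ?mul0r.
case: (a =P ord0) ia => [->|_ _]; last by rewrite !mul0r.
by case: (i =P ord0) => // _ _; rewrite mul0r mulr0.
Qed.

Lemma natural_hw_part : par ord0 = false -> natural_hw \in gl_part N0 false.
Proof.
move=> h1; apply/mem_natural_part=> a; rewrite eqbF_neg negbK => pa; rewrite !mxE.
by case: eqP pa => [->|//]; rewrite h1.
Qed.

End PureTensor.

(** * Solutions of the Bethe equations give singular vectors *)

Section BetheVector.
Context (R : realType) (r : nat) (par : 'I_r.+1 -> bool) (h1 : par ord0 = false).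
Context (V : gl_module R par) (lam : 'rV[R[i]]_r.+1) (v : V) (hv : highest_weight_vector lam v).
Context (L : nat) (c : 'I_L -> 'I_r) (z1 z2 : R[i]) (t : {ffun 'I_L -> R[i]}).
Context (ht : bethe_solution par c z1 z2 t lam).
Local Notation T := (natural_tensor V).
Local Notation psign := (psign R par).
Local Notation wt_form := (wt_form par).
Local Notation e0 := (natural_hw R par).

Let word s1 s2 : T := pure_tensor (applyF [seq c i | i <- s1] e0) (applyF [seq c i | i <- s2] v).

Let height p nu s := wt_form (alpha R p) (nu - \sum_(y <- s) alpha R (c y)).

(** The term in which the raising operator deletes [i] from the first factor; [partB] is the one for
    the second factor, whose sign also records the passage over the whole first factor. *)
Let partA p i s1 s2 : T :=
  ((-1) ^+ (parF par p && word_parity par c (take (index i s1) s1)) *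
   (psign (pos0 p) * height p (eps R ord0) (drop (index i s1).+1 s1))) *: word (rem i s1) s2.

Let partB p i s1 s2 : T :=
  ((-1) ^+ (parF par p && (word_parity par c s1 (+) word_parity par c (take (index i s2) s2))) *
   (psign (pos0 p) * height p lam (drop (index i s2).+1 s2))) *: word s1 (rem i s2).

Lemma raise_pure p s1 s2 : uniq (s1 ++ s2) ->
  gl_act T (pos0 p) (pos1 p) (word s1 s2) =
  \sum_(i | c i == p) ((if i \in s1 then partA p i s1 s2 else 0)
                     + (if i \in s2 then partB p i s1 s2 else 0)).
Proof.
have [_ _ vs vw] := hv.
rewrite cat_uniq => /and3P[u1 _ u2].
rewrite /word (@act_pure_tensor _ _ _ _ _ _ (word_parity par c s1)); last first.
  by rewrite -[word_parity _ _ _]addFb; apply: applyF_part; exact: natural_hw_part.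
have sum_uniq (s : seq 'I_L) (F : 'I_L -> T) : uniq s ->
    \sum_(i <- s | c i == p) F i = \sum_(i | c i == p) (if i \in s then F i else 0).
  by move=> us; rewrite big_mkcond big_uniq //= -big_mkcondl big_mkcondr.
rewrite big_split /= -!sum_uniq //; congr (_ + _).
  by rewrite (raise_word c (natural_hw_singular R par) (natural_hw_weight R par)) //
    pure_tensor_suml.
rewrite (raise_word c vs vw) // pure_tensor_sumr scaler_sumr; apply: eq_bigr => i _.
rewrite scalerA mulrA -signr_addb /partB andb_addr.
by have -> : parE par (pos0 p) (pos1 p) = parF par p by rewrite /parF /parE addbC.
Qed.

Let total p i s k : T :=
  ((-1) ^+ inversions par c s * (omega t z1 (take k s) * omega t z2 (drop k s))) *:
  ((if i \in take k s then partA p i (take k s) (drop k s) else 0)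
   + (if i \in drop k s then partB p i (take k s) (drop k s) else 0)).

(** Fix the word [u] left after deleting [i], and a cut [k] of it. By [omega_insert] on each side of
    the cut, the sum over the positions of [i] is a multiple of the Bethe equation of [t i]. *)
Lemma total_insert p i n u : c i = p -> uniq (i :: u) -> size u = n ->
  (forall F : 'I_L -> R[i], \sum_(j <- u) F j = \sum_(j | j != i) F j) ->
  \sum_(0 <= j < n.+1) \sum_(0 <= k < n.+2) total p i (insert_at j i u) k = 0.
Proof.
move=> cip uiu un usum; have [tinj tz1 tz2 teq] := ht.
have := uiu; rewrite cons_uniq => /andP[iu uu].
pose X j k := ((-1) ^+ inversions par c (insert_at j i u) *
    (omega t z1 (take k (insert_at j i u)) * omega t z2 (drop k (insert_at j i u)))) *:
    partA p i (take k (insert_at j i u)) (drop k (insert_at j i u)).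
pose Y j k := ((-1) ^+ inversions par c (insert_at j i u) *
    (omega t z1 (take k (insert_at j i u)) * omega t z2 (drop k (insert_at j i u)))) *:
    partB p i (take k (insert_at j i u)) (drop k (insert_at j i u)).
pose sg : R[i] := (-1) ^+ odd (inversions par c (i :: u)).
(* The sign of inserting [i] at [j] equals the one the raising operator picks up in reaching it, so
   their product does not depend on [j]. *)
have sgE j : (j <= size u)%N -> (-1) ^+ inversions par c (insert_at j i u)
     = sg * (-1) ^+ (parF par p && word_parity par c (take j u)).
  by move=> ju; rewrite -signr_odd inversions_insert // cip signr_addb.
have split_total j : (j <= n)%N -> \sum_(0 <= k < n.+2) total p i (insert_at j i u) k =
    \sum_(0 <= k < n.+1) ((if (j <= k)%N then X j k.+1 else 0) + (if (k <= j)%N then Y j k else 0)).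
  move=> jn; rewrite !big_mkord -sum_cuts //; apply: eq_bigr => k _.
  rewrite /total scalerDr; congr (_ + _).
    case: ifP => [|] ik; case: ifP => jk; rewrite ?scaler0 //.
      by rewrite take_insert_ge ?un // 1?leqNgt ?jk // in ik; rewrite (mem_take ik) in iu.
    case: (nat_of_ord k) jk ik => // k' jk.
    by rewrite take_insert_lt // mem_cat mem_head orbT.
  case: ifP => [|] ik; case: ifP => jk; rewrite ?scaler0 //.
    move/negbT: jk; rewrite -ltnNge; case: (nat_of_ord k) ik => // k' + jk.
    by rewrite drop_insert_lt ?un // => /mem_drop ik; rewrite ik in iu.
  by rewrite drop_insert_ge ?un // mem_cat mem_head orbT in ik.
have -> : \sum_(0 <= j < n.+1) \sum_(0 <= k < n.+2) total p i (insert_at j i u) k =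
   \sum_(0 <= j < n.+1) \sum_(0 <= k < n.+1)
     ((if (j <= k)%N then X j k.+1 else 0) + (if (k <= j)%N then Y j k else 0)).
  by apply: eq_big_nat => j; rewrite ltnS => /andP[_ jn]; exact: split_total.
rewrite exchange_big_nat big1_seq // => k; rewrite mem_index_iota ltnS => /andP[_ /andP[_ kn]].
have itk : uniq (i :: take k u).
  by rewrite /= take_uniq // andbT; apply: contra iu; exact: mem_take.
have idk : uniq (i :: drop k u).
  by rewrite /= drop_uniq // andbT; apply: contra iu; exact: mem_drop.
have stk : size (take k u) = k by rewrite size_takel ?un.
have sdk : size (drop k u) = (n - k)%N by rewrite size_drop un.
pose K := sg * psign (pos0 p).
have XE j : (j <= k)%N -> X j k.+1 =
    (K * omega t z2 (drop k u) * (height p (eps R ord0) (drop j (take k u))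
      * omega t z1 (insert_at j i (take k u))))
     *: word (take k u) (drop k u).
  move=> jk; have ju : (j <= size u)%N by rewrite un (leq_trans jk).
  rewrite /X take_insert_lt // drop_insert_lt // /partA.
  have ni : i \notin take k u by case/andP: itk.
  rewrite index_insert_at ?stk // take_insert_at ?stk // drop_insert_at ?stk // rem_insert_at //.
  rewrite take_takel // scalerA sgE //; congr (_ *: _).
  set sj := (-1) ^+ _; have sj2 : sj * sj = 1 by rewrite /sj -signr_addb addbb.
  rewrite /K; set o1 := omega _ _ _; set o2 := omega _ _ _; set hh := height _ _ _.
  transitivity (sj * sj * (sg * psign (pos0 p) * o2 * (hh * o1))); first by ring.
  by rewrite sj2 mul1r.
have YE j : (k <= j)%N -> (j <= n)%N -> Y j k =
    (K * omega t z1 (take k u) * (height p lam (drop (j - k) (drop k u))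
      * omega t z2 (insert_at (j - k) i (drop k u))))
     *: word (take k u) (drop k u).
  move=> kj jn; have ju : (j <= size u)%N by rewrite un.
  rewrite /Y take_insert_ge // drop_insert_ge // /partB.
  have ni : i \notin drop k u by case/andP: idk.
  have jk : (j - k <= size (drop k u))%N by rewrite sdk leq_sub2r.
  rewrite index_insert_at // take_insert_at // drop_insert_at // rem_insert_at //.
  have -> : word_parity par c (take k u) (+) word_parity par c (take (j - k) (drop k u))
     = word_parity par c (take j u).
    by rewrite -word_parity_cat take_drop subnK // -{1}(take_takel u kj) cat_take_drop.
  rewrite scalerA sgE //; congr (_ *: _).
  set sj := (-1) ^+ _; have sj2 : sj * sj = 1 by rewrite /sj -signr_addb addbb.
  rewrite /K; set o1 := omega _ _ _; set o2 := omega _ _ _; set hh := height _ _ _.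
  transitivity (sj * sj * (sg * psign (pos0 p) * o1 * (hh * o2))); first by ring.
  by rewrite sj2 mul1r.
rewrite big_split /=.
have -> : \sum_(0 <= j < n.+1) (if (j <= k)%N then X j k.+1 else 0) =
   (K * omega t z2 (drop k u) * (omega t z1 (take k u) *
     (wt_form (alpha R p) (eps R ord0) / (t i - z1)
      - \sum_(y <- take k u) wt_form (alpha R p) (alpha R (c y)) / (t i - t y)))) *:
       word (take k u) (drop k u).
  rewrite -omega_insert // stk mulr_sumr scaler_suml -(sum_le _ kn).
  by apply: eq_big_nat => j _; case: ifP => // jk; exact: XE.
have -> : \sum_(0 <= j < n.+1) (if (k <= j)%N then Y j k else 0) =
   (K * omega t z1 (take k u) * (omega t z2 (drop k u) *
     (wt_form (alpha R p) lam / (t i - z2)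
      - \sum_(y <- drop k u) wt_form (alpha R p) (alpha R (c y)) / (t i - t y)))) *:
       word (take k u) (drop k u).
  rewrite -omega_insert // sdk mulr_sumr scaler_suml -(sum_ge _ kn).
  by apply: eq_big_nat => j; rewrite ltnS => /andP[_ jn]; case: ifP => // jk; exact: YE.
rewrite -scalerDl.
have := teq i; rewrite -usum -{1}(cat_take_drop k u) big_cat /= cip => eqi.
set o1 := omega t z1 _; set o2 := omega t z2 _.
set S1 := \sum_(_ <- take k u) _; set S2 := \sum_(_ <- drop k u) _.
rewrite -/S1 -/S2 in eqi.
set Z1 := _ / (t i - z1) in eqi *; set Z2 := _ / (t i - z2) in eqi *.
have -> : K * o2 * (o1 * (Z1 - S1)) + K * o1 * (o2 * (Z2 - S2))
  = - (K * o1 * o2 * (- Z1 - Z2 + (S1 + S2))).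
  by ring.
by rewrite eqi mulr0 oppr0 scale0r.
Qed.

Lemma bethe_vector_singular : weight_function v c z1 z2 t \in singular T.
Proof.
apply: simple_singular => p.
rewrite /weight_function linear_sum /=.
(* The terms are regrouped by the deleted letter [i]; permutations are then split into the position
   of [i] and the remaining word. *)
rewrite (eq_big_seq (fun s => \sum_(i | c i == p) \sum_(0 <= k < L.+1) total p i s k)).
  rewrite exchange_big big1 // => i /eqP cip.
  have ie : i \in enum 'I_L by rewrite mem_enum.
  have ue : uniq (i :: rem i (enum 'I_L)).
    by rewrite -(perm_uniq (perm_to_rem ie)) enum_uniq.
  rewrite (perm_big _ (perm_permutations (perm_to_rem ie))) /=.
  rewrite sum_permutations_insert // big1_seq // => u; rewrite mem_permutations => /andP[_ pu].
  have eL : L = (size u).+1.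
    by rewrite (perm_size pu) -[RHS]/(size (i :: _)) -(perm_size (perm_to_rem ie)) size_enum_ord.
  have sumL m (F : nat -> T) : m = (size u).+1 ->
      \sum_(0 <= k < m.+1) F k = \sum_(0 <= k < (size u).+2) F k.
    by move=> ->.
  rewrite -(perm_size pu); under eq_bigr => j _ do rewrite sumL //.
  apply: total_insert => //.
    by rewrite cons_uniq (perm_mem pu) (perm_uniq pu) -cons_uniq.
  move=> F; rewrite (perm_big _ pu) /= rem_filter ?enum_uniq // big_filter.
  by rewrite big_enum_cond.
move=> s; rewrite mem_permutations => ps; rewrite linear_sum /= -(big_mkord xpredT
  (fun k => gl_act T (pos0 p) (pos1 p) 
     (((-1) ^+ inversions par c s * (omega t z1 (take k s) * omega t z2 (drop k s))) *:
     word (take k s) (drop k s)))) [RHS]exchange_big /=.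
apply: eq_bigr => k _; rewrite linearZ /= raise_pure ?cat_take_drop; last first.
  by rewrite (perm_uniq ps) enum_uniq.
by rewrite scaler_sumr.
Qed.

End BetheVector.

Lemma omega_neq0 (R : realType) (L : nat) (t : {ffun 'I_L -> R[i]}) z s :
  injective t -> (forall i, t i != z) -> uniq s -> omega t z s != 0.
Proof.
move=> tinj tz; elim: s => [|i s IH] /=; first by rewrite oner_eq0.
move=> /andP[ims us]; rewrite mulf_neq0 ?IH // invr_neq0 // subr_eq0.
case: (s) ims => [|j s']; first by rewrite tz.
by rewrite inE negb_or => /andP[ij _]; apply: contra ij => /eqP/tinj ->.
Qed.

(** * The basis *)

Section Chains.
Context (R : realType) (r : nat) (par : 'I_r.+1 -> bool).
Local Notation e0 := (natural_hw R par).

Lemma rev_iotaS n : rev (iota 0 n.+1) = n :: rev (iota 0 n).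
Proof. by rewrite -[in LHS]addn1 iotaD rev_cat. Qed.

(** As [F_p] sends [e_p] to [e_(p+1)] and kills the other basis vectors, the word a - 1, ..., 1, 0
    alone leads from [e_0] to [e_a]. *)
Lemma applyF_natural_hw (ps : seq 'I_r) (a : 'I_r.+1) :
  (applyF ps e0) a 0 = ([seq val p | p <- ps] == rev (iota 0 a))%:R.
Proof.
elim: ps a => [|p ps IH] a /=.
  rewrite mxE eqxx andbT -val_eqE /=; case: (nat_of_ord a) => // k.
  by rewrite rev_iotaS.
rewrite [LHS]natural_EE IH pos0E.
have [->|ap] := eqVneq a (pos1 p); first by rewrite mul1r pos1E rev_iotaS eqseq_cons eqxx.
rewrite mul0r; have : (val a != p.+1) by rewrite -(pos1E p) val_eqE.
rewrite /=; case: (nat_of_ord a) => // k kp.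
rewrite rev_iotaS eqseq_cons; case: (nat_of_ord p =P k) kp => [->|_ _] //; by rewrite eqxx.
Qed.

Lemma pure_tensor_weight (V : gl_module R par) (x : natural_module R par) (y : V) nu1 nu2 :
  x \in weight_space (natural_module R par) nu1 -> y \in weight_space V nu2 ->
  pure_tensor x y \in weight_space (natural_tensor V) (nu1 + nu2).
Proof.
move=> /mem_weight_space xw /mem_weight_space yw; apply/mem_weight_space => a.
apply/ffunP=> b; rewrite tensor_actE tensorZE !pure_tensorE /parE addbb expr0 scale1r.
rewrite [gl_act V a a _]linearZ /= yw [(nu1 + nu2) 0 a]mxE !scalerA -scalerDl mulrDl.
congr ((_ + _) *: _); last by rewrite mulrC.
by have /matrixP/(_ b 0) := xw a; rewrite [LHS]natural_EE mxE.
Qed.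

Section Weight.
Context (V : gl_module R par) (lam : 'rV[R[i]]_r.+1) (v : V) (hv : highest_weight_vector lam v).
Context (L : nat) (c : 'I_L -> 'I_r) (z1 z2 : R[i]) (t : {ffun 'I_L -> R[i]}).
Local Notation w := (weight_function v c z1 z2 t).

Lemma weight_function_weight :
  w \in weight_space (natural_tensor V) (eps R ord0 + lam - \sum_i alpha R (c i)).
Proof.
have [_ _ vs vw] := hv.
rewrite /weight_function big_seq memv_suml // => s; rewrite mem_permutations => ps.
apply: memv_suml => k _; apply: memvZ.
have -> : eps R ord0 + lam - \sum_i alpha R (c i)
   = (eps R ord0 - \sum_(p <- [seq c i | i <- take k s]) alpha R p)
     + (lam - \sum_(p <- [seq c i | i <- drop k s]) alpha R p).
  rewrite addrACA -opprD !big_map -big_cat cat_take_drop (perm_big _ ps) /=.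
  by rewrite big_enum.
by apply: pure_tensor_weight; apply: applyF_weight => //; exact: natural_hw_weight.
Qed.

Lemma weight_functionE (a : 'I_r.+1) :
  w a = \sum_(s <- permutations (enum 'I_L)) \sum_(k < L.+1)
    ((-1) ^+ inversions par c s * (omega t z1 (take k s) * omega t z2 (drop k s))
     * ([seq val (c i) | i <- take k s] == rev (iota 0 a))%:R)
    *: applyF [seq c i | i <- drop k s] v.
Proof.
rewrite /weight_function sum_ffunE; apply: eq_bigr => s _.
rewrite sum_ffunE; apply: eq_bigr => k _.
by rewrite tensorZE pure_tensorE applyF_natural_hw -map_comp scalerA.
Qed.

Context (a : 'I_r.+1) (c_inj : injective c) (c_lt : forall i, (c i < a)%N)
  (c_surj : forall p : 'I_r, (p < a)%N -> exists i, c i = p).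

Lemma chain_perm : perm_eq [seq val (c i) | i <- enum 'I_L] (iota 0 a).
Proof.
apply: uniq_perm; last 1 first.
- move=> n; rewrite mem_iota add0n /=; apply/mapP/idP => [[i _ ->]|na]; first exact: c_lt.
  have nr : (n < r)%N by apply: leq_trans na _; rewrite -ltnS.
  by have [i ci] := c_surj (p := Ordinal nr) na; exists i; rewrite ?mem_enum ?ci.
- by rewrite map_inj_uniq ?enum_uniq // => i j /ord_inj/c_inj.
- exact: iota_uniq.
Qed.

Lemma chain_size : L = a :> nat.
Proof. by have := perm_size chain_perm; rewrite size_map size_enum_ord size_iota. Qed.

(** Reaching [e_b] takes [b] letters, but only [a] are available. *)
Lemma weight_function_above (b : 'I_r.+1) : (a < b)%N -> w b = 0.
Proof.
move=> ab; rewrite weight_functionE big1_seq // => s; rewrite mem_permutations => ps.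
rewrite big1 // => k _; case: eqP => [|_]; last by rewrite mulr0 scale0r.
move/(congr1 size); rewrite size_map size_rev size_iota size_take_min (perm_size ps) size_enum_ord.
move=> e; have le_bL : (b <= L)%N by rewrite -e geq_minr.
by move: ab; rewrite ltnNge -chain_size le_bL.
Qed.

Lemma weight_function_top : injective t -> (forall i, t i != z1) ->
  exists2 k, k != 0 & w a = k *: v.
Proof.
move=> tinj tz1.
pose f (i : 'I_L) := val (c i).
have f_inj : injective f by move=> i j /ord_inj/c_inj.
(* The single surviving summand: colours in decreasing order, with all letters in the first
   factor. *)
pose s0 := rev (sort (relpre f leq) (enum 'I_L)).
have s0E : [seq f i | i <- s0] = rev (iota 0 a).
  rewrite map_rev -sort_map; congr rev.
  apply: (sorted_eq leq_trans anti_leq); [exact: sort_sorted leq_total _|exact: iota_sorted|].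
  by rewrite perm_sort chain_perm.
have ps0 : perm_eq s0 (enum 'I_L) by rewrite perm_rev perm_sort.
have us0 : uniq s0 by rewrite (perm_uniq ps0) enum_uniq.
exists ((-1) ^+ inversions par c s0 * omega t z1 s0).
  by rewrite mulf_neq0 ?signr_eq0 ?omega_neq0.
rewrite weight_functionE.
have sz s : perm_eq s (enum 'I_L) -> size s = L by move=> /perm_size ->; rewrite size_enum_ord.
rewrite (bigD1_seq s0) ?permutations_uniq ?mem_permutations //=.
rewrite [X in _ + X]big1_seq ?addr0; last first.
  move=> s; rewrite mem_permutations => /andP[ss0 ps]; rewrite big1 // => k _.
  case: eqP => [e|_]; last by rewrite mulr0 scale0r.
  have kL : k = L :> nat.
    move/(congr1 size): (e); rewrite size_map size_rev size_iota size_take_min sz // -chain_size.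
    by move/minn_idPr => Lk; apply/eqP; rewrite eqn_leq Lk -ltnS ltn_ord.
  case/eqP: ss0; apply: (inj_map f_inj); rewrite s0E -e take_oversize // sz // kL.
  by [].
rewrite big_ord_recr /= big1 ?add0r => [|k _]; last first.
  case: eqP => [/(congr1 size)|_]; last by rewrite mulr0 scale0r.
  rewrite size_map size_rev size_iota size_takel ?sz // -?chain_size; last exact: ltnW.
  by move=> kL; have := ltn_ord k; rewrite kL ltnn.
by rewrite take_oversize ?sz // drop_oversize ?sz // s0E eqxx /= !mulr1.
Qed.

End Weight.

Lemma simple_root_combination (l : 'I_r -> nat) (a : 'I_r.+1) :
  \sum_p (l p)%:R *: alpha R p = eps R ord0 - eps R a -> forall p, l p = (p < a)%N.
Proof.
move=> e p; apply/eqP; rewrite -(eqr_nat R[i]); apply/eqP.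
(* A functional equal to 1 on [alpha R p] and 0 on the other simple roots, so it extracts [l p]. *)
pose S (x : 'rV[R[i]]_r.+1) := \sum_(b : 'I_r.+1 | (b <= p)%N) x 0 b.
have Seps b : S (eps R b) = (b <= p)%N%:R.
  rewrite /S; case: leqP => bp; last first.
    rewrite big1 // => d dp; rewrite mxE eqxx; case: eqP dp => // ->; by rewrite leqNgt bp.
  rewrite (bigD1 b) //= big1 ?addr0 => [|d /andP[_ /negPf db]]; first by rewrite mxE !eqxx.
  by rewrite mxE eqxx db.
have SB x y : S (x - y) = S x - S y.
  by rewrite /S -sumrB; apply: eq_bigr => b _; rewrite !mxE.
have := congr1 S e; rewrite SB !Seps leq0n.
have -> : S (\sum_p0 (l p0)%:R *: alpha R p0) = \sum_q (l q)%:R * S (alpha R q).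
  rewrite /S; under eq_bigr => b _ do rewrite summxE.
  rewrite exchange_big; apply: eq_bigr => q _; rewrite mulr_sumr; apply: eq_bigr => b _.
  by rewrite mxE.
rewrite (bigD1 p) //= big1 ?addr0 => [|q qp].
  by rewrite SB !Seps pos0E pos1E leqnn ltnn subr0 mulr1 => ->;
    case: ltnP => _; rewrite ?subr0 ?subrr.
rewrite SB !Seps pos0E pos1E [(q < p)%N]ltn_neqAle.
by have -> : (q != p :> nat) by []; rewrite subrr mulr0.
Qed.

End Chains.

(** * The nonzero Bethe vectors form a basis *)

Section Basis.
Context (R : realType) (r : nat) (par : 'I_r.+1 -> bool) (h1 : par ord0 = false).
Context (V : gl_module R par) (lam : 'rV[R[i]]_r.+1) (v : V).
Context (irrV : irreducible V) (hv : highest_weight_vector lam v) (H : hermitian_form V).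
Context (c : forall l : {ffun 'I_r -> nat}, 'I_(\sum_p l p)%N -> 'I_r)
    (hc : forall l p, #|[pred i | @c l i == p]| = l p)
    (z1 z2 : R[i]) (hz : z1 != z2).
Local Notation T := (natural_tensor V).

(** The tuple for weight [lam + eps R a], since [eps R ord0 - eps R a] is the sum of the simple
    roots below [a]. *)
Definition chain_tuple (a : 'I_r.+1) : {ffun 'I_r -> nat} := [ffun p : 'I_r => (p < a)%N : nat].

Lemma chain_color_inj a : injective (@c (chain_tuple a)).
Proof.
move=> i j cij; apply/eqP; apply: contraT => ij.
have := hc (chain_tuple a) (@c (chain_tuple a) i).
rewrite ffunE (cardD1 i) inE eqxx (cardD1 j) !inE eq_sym ij -cij eqxx.
by case: (_ < _)%N.
Qed.

Lemma chain_color_lt a i : (@c (chain_tuple a) i < a)%N.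
Proof.
have := hc (chain_tuple a) (@c (chain_tuple a) i).
by rewrite ffunE (cardD1 i) inE eqxx; case: (_ < a)%N.
Qed.

Lemma chain_color_surj (a : 'I_r.+1) (p : 'I_r) : (p < a)%N -> exists i, @c (chain_tuple a) i = p.
Proof.
move=> pa; have /card_gt0P[j] : (0 < #|[pred i | @c (chain_tuple a) i == p]|)%N.
  by rewrite hc ffunE pa.
by rewrite inE => /eqP; exists j.
Qed.

Definition chain_bethe (a : 'I_r.+1) := chain_solution_fun par lam z1 z2 a (@c (chain_tuple a)).

Definition chain_vector (a : 'I_r.+1) : T :=
  weight_function v (@c (chain_tuple a)) z1 z2 (chain_bethe a).

(** The point [chain_bethe a] is only the candidate from the elimination; this records whether it
    solves the equations. *)
Definition admissible (a : 'I_r.+1) : bool :=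
  `[< bethe_solution par (@c (chain_tuple a)) z1 z2 (chain_bethe a) lam >].

(** The top coordinate is singular in [V]: [E_ad] sends it to a multiple of [u d] with d > a, which
    is zero, and the other raising operators kill it. *)
Lemma singular_top (a : 'I_r.+1) (u : T) :
  u \in lower_singular V a.+1 -> exists k, u a = k *: v.
Proof.
move=> /mem_lower_singular[us u0]; apply: (singular_irreducible irrV hv H).
apply/mem_singular=> b d bd; have [ab|ab] := eqVneq a b.
  by rewrite ab singular_diag // -ab u0 ?scaler0 // ab.
exact: singular_offdiag.
Qed.

Lemma admissible_top (a : 'I_r.+1) (u : T) k :
  u \in lower_singular V a.+1 -> u a = k *: v -> k != 0 -> admissible a.
Proof.
move=> ul ua k0; apply/asboolP; apply: bethe_chain_solution => //.
- exact: chain_color_inj.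
- exact: chain_color_lt.
- by move=> p; exact: chain_color_surj.
have [HT HTE] := hform_natural_tensor H.
move=> i ia; apply: (content_gap_gt0 HTE hv (u := k^-1 *: u)) => //.
  by rewrite memvZ.
by rewrite tensorZE ua scalerA mulVf // scale1r.
Qed.

Lemma chain_vector_top a : admissible a ->
  chain_vector a \in lower_singular V a.+1 /\ exists2 k, k != 0 & chain_vector a a = k *: v.
Proof.
move=> /asboolP ga; have [tinj tz1 _ _] := ga.
have surj p := @chain_color_surj a p.
split; last exact: (weight_function_top _ _ (@chain_color_inj a) (@chain_color_lt a) surj tinj tz1).
apply/mem_lower_singular; split; first exact: (bethe_vector_singular h1 hv ga).
move=> b; exact: (weight_function_above _ _ _ _ (@chain_color_inj a) (@chain_color_lt a) surj).
Qed.

Lemma chain_vector_neq0 a : admissible a -> chain_vector a != 0.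
Proof.
move=> /chain_vector_top[_ [k k0 e]]; apply: contraNneq k0 => w0.
move: e; rewrite w0 ffunE => /esym/eqP; rewrite scaler_eq0.
by case: hv => /negPf -> _ _ _; rewrite orbF.
Qed.

(** The top coordinate of [u], say at [a], is a nonzero multiple of [v], so the weight of [u] must
    be [lam + eps R a]. *)
Lemma singular_weight (u : T) (l : {ffun 'I_r -> nat}) :
  u \in singular T -> u != 0 ->
  u \in weight_space T (eps R ord0 + lam - \sum_p (l p)%:R *: alpha R p) ->
  exists a, l = chain_tuple a.
Proof.
move=> us u0 /mem_weight_space uw.
have [v0 _ _ /mem_weight_space vw] := hv.
have ex : exists n, u \in lower_singular V n.
  by exists r.+1; apply/mem_lower_singular; split=> // a; rewrite leqNgt ltn_ord.
have [[|n] un nmin] := ex_minnP ex.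
  case/eqP: u0; apply/ffunP=> a; rewrite ffunE.
  by have /mem_lower_singular[_ ->] := un.
have nr : (n < r.+1)%N.
  by apply: nmin; apply/mem_lower_singular; split=> // a; rewrite leqNgt ltn_ord.
pose a := Ordinal nr; have [k ua] := singular_top (a := a) un.
have k0 : k != 0.
  apply/eqP => k0; have : u \in lower_singular V n; last by move/nmin; rewrite ltnn.
  have /mem_lower_singular[_ uz] := un; apply/mem_lower_singular; split=> // b.
  rewrite leq_eqVlt => /predU1P[nb|]; last exact: uz.
  by have -> : b = a by [apply: ord_inj]; rewrite ua k0 scale0r.
exists a; apply/ffunP=> p; rewrite ffunE; apply: (@simple_root_combination R) => {p}.
set S := \sum_p _ in uw *.
apply/rowP=> b; have /ffunP/(_ a) := uw b.
rewrite tensor_actE tensorZE /parE addbb expr0 scale1r ua linearZ /= vw.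
have -> : (a == b)%:R *: u b = (a == b)%:R *: (k *: v).
  by case: eqP => [<-|_]; rewrite ?ua // !scale0r.
rewrite !scalerA -scalerDl => /eqP; rewrite -subr_eq0 -scalerBl scaler_eq0 (negPf v0) orbF.
rewrite [k * _]mulrC -mulrDl -mulrBl mulf_eq0 (negPf k0) orbF subr_eq0 => /eqP e.
have -> : S 0 b = (eps R ord0 + lam) 0 b - ((a == b)%:R + lam 0 b).
  by rewrite e !mxE; ring.
by rewrite !mxE eqxx [b == a]eq_sym /=; ring.
Qed.

(** Listed by decreasing [a], so that every later vector vanishes at the top coordinate of an
    earlier one. *)
Definition chain_basis : seq T := [seq chain_vector a | a <- rev (enum 'I_r.+1) & admissible a].

(** If the top coordinate of [u] is nonzero, its index is admissible, and subtracting a multiple of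
    the chain vector moves [u] down the filtration. *)
Lemma lower_singular_span n (u : T) : u \in lower_singular V n -> u \in <<chain_basis>>%VS.
Proof.
elim: n u => [|n IH] u un.
  have /mem_lower_singular[_ uz] := un.
  by have -> : u = 0 by [apply/ffunP=> a; rewrite ffunE uz]; rewrite mem0v.
have [us uz] := mem_lower_singular _ _ un.
have down : (forall a : 'I_r.+1, a = n :> nat -> u a = 0) -> u \in <<chain_basis>>%VS.
  move=> h; apply: IH; apply/mem_lower_singular; split=> // b.
  by rewrite leq_eqVlt => /predU1P[/esym/h|/uz].
have [rn|nr] := leqP r.+1 n.
  by apply: down => a e; have := ltn_ord a; rewrite e ltnNge rn.
pose a := Ordinal nr; have [k ua] := singular_top (a := a) un.
have [k0|k0] := eqVneq k 0.
  by apply: down => b e; have -> : b = a by [apply: ord_inj]; rewrite ua k0 scale0r.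
have ga := admissible_top (a := a) un ua k0.
have [wl [k' k'0 wa]] := chain_vector_top ga.
have -> : u = (u - (k / k') *: chain_vector a) + (k / k') *: chain_vector a by rewrite subrK.
rewrite memvD ?memvZ //; last first.
  by apply: memv_span; apply: map_f; rewrite mem_filter ga mem_rev mem_enum.
have /mem_lower_singular[ws wz] := wl.
apply: IH; apply/mem_lower_singular; split; first by rewrite memvB ?memvZ.
move=> b; rewrite leq_eqVlt tensorDE tensorNE tensorZE => /predU1P[nb|nb].
  have -> : b = a by apply: ord_inj.
  by rewrite ua wa scalerA divfK // subrr.
by rewrite uz // wz // scaler0 subrr.
Qed.

Lemma chain_basis_free : free chain_basis.
Proof.
have : sorted (fun a b : 'I_r.+1 => (b < a)%N) [seq a <- rev (enum 'I_r.+1) | admissible a].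
  apply: sorted_filter; first by move=> a b d ab bd; exact: ltn_trans bd ab.
  by rewrite rev_sorted; have := iota_ltn_sorted 0 r.+1; rewrite -val_enum_ord sorted_map.
have : all admissible [seq a <- rev (enum 'I_r.+1) | admissible a] by exact: filter_all.
rewrite /chain_basis; elim: [seq _ <- _ | _] => [|a s IH] /=; first by rewrite nil_free.
move=> /andP[ga gs] sas; rewrite free_cons IH ?(path_sorted sas) // andbT.
have lt b : b \in s -> (b < a)%N.
  have tr : transitive (fun a b : 'I_r.+1 => (b < a)%N).
    by move=> x y z yx xz; exact: ltn_trans xz yx.
  by move=> bs; have /allP/(_ b bs) := order_path_min tr sas.
have sub : (<<[seq chain_vector b | b <- s]>> <= lower_singular V a)%VS.
  apply/span_subvP=> _ /mapP[b bs ->].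
  have [/mem_lower_singular[ws wz] _] := chain_vector_top (allP gs b bs).
  by apply/mem_lower_singular; split=> // d ad; apply: wz; exact: leq_trans (lt b bs) ad.
apply/negP => /(subvP sub)/mem_lower_singular[_ /(_ a (leqnn _))].
have [_ [k k0 ->]] := chain_vector_top ga => /eqP; rewrite scaler_eq0 (negPf k0).
by case: hv => /negPf ->.
Qed.

Lemma chain_basis_basis : basis_of (singular T) chain_basis.
Proof.
rewrite /basis_of chain_basis_free andbT eqEsubv; apply/andP; split.
  apply/span_subvP=> x /mapP[a]; rewrite mem_filter => /andP[ga _] ->.
  by have [/mem_lower_singular[ws _] _] := chain_vector_top ga.
apply/subvP=> u us; apply: (lower_singular_span (n := r.+1)).
by apply/mem_lower_singular; split=> // a; rewrite leqNgt ltn_ord.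
Qed.

Lemma chain_tuple_unique a t :
  bethe_solution par (@c (chain_tuple a)) z1 z2 t lam -> t = chain_bethe a.
Proof.
move=> ht; have surj p := @chain_color_surj a p.
exact: (bethe_chain_unique hz (@chain_color_inj a) (@chain_color_lt a) surj ht).
Qed.

Lemma bethe_vector_weight (l : {ffun 'I_r -> nat}) t :
  weight_function v (@c l) z1 z2 t \in
    weight_space T (eps R ord0 + lam - \sum_p (l p)%:R *: alpha R p).
Proof.
have -> : \sum_p (l p)%:R *: alpha R p = \sum_i alpha R (@c l i).
  rewrite [RHS](partition_big (@c l) xpredT) //=; apply: eq_bigr => p _.
  rewrite (eq_bigr (fun=> alpha R p)); last by move=> i /eqP ->.
  by rewrite sumr_const scaler_nat hc.
exact: weight_function_weight.
Qed.

Lemma mem_chain_basis (w : T) :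
  w \in chain_basis <->
  w != 0 /\
  exists (l : {ffun 'I_r -> nat}) (t : {ffun 'I_(\sum_p l p)%N -> R[i]}),
    bethe_solution par (@c l) z1 z2 t lam /\ w = weight_function v (@c l) z1 z2 t.
Proof.
split=> [/mapP[a]|[w0 [l [t [ht e]]]]].
  rewrite mem_filter => /andP[ga _] ->; split; first exact: chain_vector_neq0.
  by exists (chain_tuple a), (chain_bethe a); split=> //; exact/asboolP.
have ws : w \in singular T by rewrite e; exact: (bethe_vector_singular h1 hv ht).
have ww := bethe_vector_weight t; rewrite -e in ww.
have [a la] := singular_weight ws w0 ww.
(* The weight fixes the tuple and the chain elimination fixes the solution. *)
subst l; have ta := chain_tuple_unique ht; subst t.
rewrite e; apply: map_f; rewrite mem_filter mem_rev mem_enum andbT.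
exact/asboolP.
Qed.

(** A nonzero singular vector of this weight would make [l] a chain tuple and [t] its chain
    solution, whose Bethe vector is nonzero. *)
Lemma vanishing_bethe_vector (l : {ffun 'I_r -> nat}) (t : {ffun 'I_(\sum_p l p)%N -> R[i]}) :
  bethe_solution par (@c l) z1 z2 t lam -> weight_function v (@c l) z1 z2 t = 0 ->
  (singular T :&: weight_space T (eps R ord0 + lam - \sum_p (l p)%:R *: alpha R p) = 0)%VS.
Proof.
move=> ht w0; apply/eqP; rewrite -subv0; apply/subvP=> u; rewrite memv_cap memv0 => /andP[us uw].
apply: contraT => u0; have [a la] := singular_weight us u0 uw.
subst l; have ta := chain_tuple_unique ht; subst t.
have ga : admissible a by exact/asboolP.
by have := chain_vector_neq0 ga; rewrite /chain_vector w0 eqxx.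
Qed.

End Basis.

Theorem theorem4p5 (R : realType) (m n r : nat) (par : 'I_r.+1 -> bool)
    (hm : #|[pred a | ~~ par a]| = m) (hn : #|[pred a | par a]| = n)
    (h1 : par ord0 = false)
    (mu : seq nat) (hmu : hook_partition m n mu)
    (V : gl_module R par) (hV : irreducible_polynomial V)
    (v : V) (hv : highest_weight_vector (hook_weight R par mu) v)
    (c : forall l : {ffun 'I_r -> nat}, 'I_(\sum_p l p)%N -> 'I_r)
    (hc : forall l p, #|[pred i | c l i == p]| = l p)
    (z1 z2 : R[i]) (hz : z1 != z2) :
  (exists X : seq (natural_tensor V),
     basis_of (singular (natural_tensor V)) X
     /\ forall w : natural_tensor V,
          w \in X <->
          w != 0 /\
          exists (l : {ffun 'I_r -> nat}) (t : {ffun 'I_(\sum_p l p)%N -> R[i]}),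
            bethe_solution par (c l) z1 z2 t (hook_weight R par mu)
            /\ w = weight_function v (c l) z1 z2 t)
  /\ (forall (l : {ffun 'I_r -> nat}) (t : {ffun 'I_(\sum_p l p)%N -> R[i]}),
        bethe_solution par (c l) z1 z2 t (hook_weight R par mu) ->
        weight_function v (c l) z1 z2 t = 0 ->
        (singular (natural_tensor V)
         :&: weight_space (natural_tensor V)
               (eps R ord0 + hook_weight R par mu
                - \sum_p (l p)%:R *: alpha R p)%R = 0)%VS).
Proof.
have [irrV [k Vk]] := hV.
(* Polynomiality enters here: the form is pulled back along the embedding of [V] in a tensor
   power. *)
have [H] := hform_embeds Vk (hform_tensor_power R par k).
split=> [|l t]; last exact: (vanishing_bethe_vector h1 irrV hv H hc hz).
exists (chain_basis (hook_weight R par mu) v c z1 z2).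
split; first exact: chain_basis_basis.
by move=> w; exact: mem_chain_basis.
Qed.
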